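(* The function $H(\alpha,\beta;\gamma)$ of three complex variables, defined for $\frac{\alpha+1}{2},\frac{\beta+1}{2},\gamma+1,\frac{\alpha+\beta+1}{2}-\gamma\notin\mathbb{Z}_{\le0}$ by $$H(\alpha,\beta;\gamma)=\frac{1}{\mathrm{CF}\left[\Delta\bigl(n(n+\alpha)(n+\beta)\bigr),\,-2n(n+\alpha)(n+\beta)(n+\gamma)\right]},$$ is regular (i.e. holomorphic) in each of the variables $\alpha,\beta,\gamma$.
   Context: For sequences $(a_n)_{n\ge0}$, $(b_n)_{n\ge1}$ of complex numbers, $\mathrm{CF}[a_n,b_n]$ denotes the continued fraction $a_0+\cfrac{b_1}{a_1+\cfrac{b_2}{a_2+\ddots}}$, whose value is $\lim_{n\to\infty}A_n/B_n$ (in $\mathbb{C}\cup\{\infty\}$), where $A_0=1$, $A_1=a_0$, $B_0=0$, $B_1=1$, and $A_{n+1}=a_nA_n+b_nA_{n-1}$, $B_{n+1}=a_nB_n+b_nB_{n-1}$ for $n\ge1$. The reciprocal uses $1/\infty=0$, so $H=\lim_{n\to\infty}B_n/A_n$. $\Delta f(n)=f(n+1)-f(n)$ is the difference operator in the variable $n$. *)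

(* Defs.v *)
From Stdlib Require Import Reals ClassicalEpsilon.
From Coquelicot Require Import Coquelicot.

Open Scope R_scope.
Open Scope C_scope.

(** The Riemann sphere, [None] being the point at infinity. *)
Definition sphere : Type := option C.

(** [q] nonzero or [p] nonzero is assumed: the pair [(0, 0)] gets the junk
    value [None], and must be ruled out where this function is used. *)
Definition sphere_div (p q : C) : sphere :=
  if Ceq_dec q 0 then None else Some (p / q).

(** 1/oo = 0 and 1/0 = oo. *)
Definition sphere_inv (v : sphere) : sphere :=
  match v with
  | None => Some (RtoC 0)
  | Some z => sphere_div 1 z
  end.

Definition sphere_locally (v : sphere) (P : sphere -> Prop) : Prop :=
  match v with
  | Some z => locally z (fun w : C => P (Some w))
  | None => P None /\ exists M : R, forall w : C, (M < Cmod w)%R -> P (Some w)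
  end.

(** Solution of [x (n+1) = a n * x n + b n * x (n-1)] for [n >= 1], with
    [x 0 = x0] and [x 1 = x1]; the value [b 0] is never used. *)
Fixpoint CF_rec (a b : nat -> C) (x0 x1 : C) (n : nat) : C :=
  match n with
  | O => x0
  | S m =>
      match m with
      | O => x1
      | S k => a m * CF_rec a b x0 x1 m + b m * CF_rec a b x0 x1 k
      end
  end.

Definition CF_A (a b : nat -> C) : nat -> C := CF_rec a b 1 (a O).
Definition CF_B (a b : nat -> C) : nat -> C := CF_rec a b 0 1.

(** A convergent [A n / B n] is a point of the sphere only if [A n] and [B n]
    are not both zero.  This can fail for some [n] when some [b m] vanishes;
    finitely many such [n] do not affect the limit. *)
Definition is_CF (a b : nat -> C) (v : sphere) : Prop :=
  eventually (fun n => CF_A a b n <> 0 \/ CF_B a b n <> 0) /\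
  filterlim (fun n => sphere_div (CF_A a b n) (CF_B a b n))
    eventually (sphere_locally v).

(** Meaningful only when [is_CF a b v] holds for some [v]. *)
Definition CF (a b : nat -> C) : sphere :=
  epsilon (inhabits None) (is_CF a b).

Definition Delta (f : nat -> C) (n : nat) : C := f (S n) - f n.

Definition H_a (alpha beta : C) : nat -> C :=
  Delta (fun n => INR n * (INR n + alpha) * (INR n + beta)).

Definition H_b (alpha beta gamma : C) (n : nat) : C :=
  - 2 * INR n * (INR n + alpha) * (INR n + beta) * (INR n + gamma).

Definition H (alpha beta gamma : C) : sphere :=
  sphere_inv (CF (H_a alpha beta) (H_b alpha beta gamma)).

Definition nonpos_int (z : C) : Prop := exists k : nat, z = - INR k.

Definition H_domain (alpha beta gamma : C) : Prop :=
  ~ nonpos_int ((alpha + 1) / 2) /\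
  ~ nonpos_int ((beta + 1) / 2) /\
  ~ nonpos_int (gamma + 1) /\
  ~ nonpos_int ((alpha + beta + 1) / 2 - gamma).

(** Near [z], [f] is finite and complex differentiable: [ex_derive] is taken
    over the field [C], not over the reals. *)
Definition regular_at (f : C -> sphere) (z : C) : Prop :=
  exists g : C -> C,
    locally z (fun w : C =>
      f w = Some (g w) /\ @ex_derive C_AbsRing C_NormedModule g w).

(* Main.v *)
(** After division by (n!)^2 the recurrence tends to x'' = 3 x' - 2 x, whose
    solutions are 2^n and 1. Hence the cone of solutions dominated by 2^n is
    invariant, and a solution that never enters it grows at most like 1.01^n.
    If A_N is in the cone for one large N, then so it is for all nearby
    parameters, and the increments of B_n/A_n, which are the Wronskian divided
    by A_n A_(n+1), tend to 0 geometrically, together with their Lipschitz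
    constants in the parameters. The limit is then holomorphic.

    That A_n does enter the cone is the heart of the matter. Put
    b = (alpha+beta+1)/2 - gamma. Up to a product v_n of factors
    (i+alpha)(i+beta), A_n is the binomial transform sum_j C(n,j) g_j, where
    g_j vanishes for odd j and
      (j+2+alpha)(j+2+beta) g_(j+2) = (j+1)(j+2b) g_j.
    (If alpha or beta is a negative even integer, the sum starts at the last
    zero of (j+alpha)(j+beta).) The hypotheses on alpha, beta and b say that g
    does not terminate. Since g_(j+2)/g_j = 1 + O(1/j), for large r the
    sequence j^r g_j varies so slowly on the scale sqrt(n) of the binomial law
    that its transform has order at least 2^n; but if the transform of g were
    O(1.2^n), that of j^r g_j would be O(1.5^n). *)

(* The explicit formula for A_n is not uniform in the parameters: the index where its sum starts
   jumps when alpha or beta passes through a negative even integer. It is therefore used only at the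
   point where regularity is to be proved, and only to refute slow growth there. All uniformity
   comes from the cone, an open condition on two consecutive numerators.

   The weight j^r makes second moments suffice. If g_j decays like a power of j, its values at small
   j dwarf those near the mean, and exponential tail bounds would be needed. Once |h_j|/j increases,
   where h_j = j^r g_j, every increment of h up to twice the mean is controlled by |h_j|/j at the
   mean, so h is Lipschitz on the whole range and the variance of the binomial law is enough. The
   price is low: multiplying by j turns the transform T_n into n (T_n - T_(n-1)), which does not
   raise its exponential rate.

   The gap between 1.01 and 2 leaves room for crude bounds. In particular v_n is only bounded below
   by a multiple of (9/10)^n (n!)^2, whence the rate 1.2, which exceeds 1.01/0.9. *)
Require Import Defs.
From Stdlib Require Import Reals Factorial Wf_nat Lra Lia Psatz.
From Stdlib Require Import Classical ClassicalEpsilon.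
From Coquelicot Require Import Coquelicot.

Open Scope C_scope.

(** * The binomial transform *)

(** [bt n f] is the sum of [C(n, j) * f j] over [j <= n]. *)
Fixpoint bt (n : nat) (f : nat -> C) : C :=
  match n with
  | O => f O
  | S m => bt m f + bt m (fun j => f (S j))
  end.

Lemma INR_S_C (n : nat) : RtoC (INR (S n)) = INR n + 1.
Proof. now rewrite S_INR, RtoC_plus. Qed.

Lemma bt_ext (n : nat) (f g : nat -> C) :
  (forall j, (j <= n)%nat -> f j = g j) -> bt n f = bt n g.
Proof.
  revert f g; induction n as [|n IH]; intros f g Hfg; simpl.
  - apply Hfg; lia.
  - f_equal; apply IH; intros j Hj; apply Hfg; lia.
Qed.

Lemma bt_plus (n : nat) (f g : nat -> C) :
  bt n (fun j => f j + g j) = bt n f + bt n g.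
Proof.
  revert f g; induction n as [|n IH]; intros f g; simpl; [reflexivity|].
  rewrite (IH f g), (IH (fun j => f (S j)) (fun j => g (S j))); ring.
Qed.

Lemma bt_scal (n : nat) (c : C) (f : nat -> C) :
  bt n (fun j => c * f j) = c * bt n f.
Proof.
  revert f; induction n as [|n IH]; intros f; simpl; [reflexivity|].
  rewrite (IH f), (IH (fun j => f (S j))); ring.
Qed.

Lemma bt_last (n : nat) (f : nat -> C) :
  (forall j, (j < n)%nat -> f j = 0) -> bt n f = f n.
Proof.
  revert f; induction n as [|n IH]; intros f Hf; simpl; [reflexivity|].
  rewrite (IH (fun j => f (S j))) by (intros j Hj; apply Hf; lia).
  rewrite (IH f) by (intros j Hj; apply Hf; lia).
  rewrite (Hf n) by lia; ring.
Qed.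

(** Absorption: j C(n+1, j) = (n+1) C(n, j-1). *)
Lemma bt_shift (n : nat) (f : nat -> C) :
  bt (S n) (fun j => INR j * f j) = INR (S n) * bt n (fun j => f (S j)).
Proof.
  revert f; induction n as [|n IH]; intros f.
  - simpl; ring.
  - change (bt (S n) (fun j => INR j * f j) + bt (S n) (fun j => INR (S j) * f (S j))
      = INR (S (S n)) * (bt n (fun j => f (S j)) + bt n (fun j => f (S (S j))))).
    rewrite IH.
    rewrite (bt_ext (S n) (fun j => INR (S j) * f (S j))
      (fun j => INR j * f (S j) + f (S j))).
    2:{ intros j _; rewrite INR_S_C; ring. }
    rewrite bt_plus, (IH (fun j => f (S j))).
    change (bt (S n) (fun j => f (S j))) with
      (bt n (fun j => f (S j)) + bt n (fun j => f (S (S j)))).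
    rewrite !INR_S_C; ring.
Qed.

Lemma bt_mul_index (n : nat) (f : nat -> C) :
  bt (S n) (fun j => INR j * f j) = INR (S n) * (bt (S n) f - bt n f).
Proof. rewrite bt_shift; simpl bt; ring. Qed.

(** Comes from n C(n, j) = j C(n, j) + (j+1) C(n, j+1). Multiplication by the length becomes an
    operation on the sequence, so a recurrence in [n] for transforms turns into one in [j]. At
    [j = 0] the factor [INR j] kills the spurious [f (pred 0)]. *)
Lemma bt_mul_length (n : nat) (f : nat -> C) :
  INR n * bt n f = bt n (fun j => INR j * (f j + f (pred j))).
Proof.
  destruct n as [|n].
  - simpl; ring.
  - rewrite (bt_ext (S n) (fun j => INR j * (f j + f (pred j)))
      (fun j => INR j * f j + INR j * f (pred j))) by (intros; ring).
    rewrite bt_plus, !bt_shift.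
    change (fun j => f (pred (S j))) with f; simpl bt; ring.
Qed.

(** Even and odd indices carry the same binomial weight as soon as the length is positive, hence
    [S n]. *)
Lemma bt_parity (n : nat) (a b : C) :
  bt (S n) (fun j => if Nat.even j then a else b) = 2 ^ n * (a + b).
Proof.
  revert a b; induction n as [|n IH]; intros a b.
  - simpl; ring.
  - change (bt (S n) (fun j => if Nat.even j then a else b) +
      bt (S n) (fun j => if Nat.even (S j) then a else b) = 2 ^ S n * (a + b)).
    rewrite IH.
    rewrite (bt_ext (S n) _ (fun j => if Nat.even j then b else a)).
    2:{ intros j _; rewrite Nat.even_succ, <- Nat.negb_even; now destruct (Nat.even j). }
    rewrite IH; simpl; ring.
Qed.

(** [n + (n - c)^2] is the expectation of [(2 j - c)^2] for a binomial
    variable [j] of parameters [n], [1/2]. *)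
Lemma bt_bound_square (n : nat) (f : nat -> C) (u w c : R) :
  (forall j, (j <= n)%nat -> (Cmod (f j) <= u + w * (2 * INR j - c) ^ 2)%R) ->
  (Cmod (bt n f) <= 2 ^ n * (u + w * (INR n + (INR n - c) ^ 2)))%R.
Proof.
  revert f c; induction n as [|n IH]; intros f c Hf; simpl bt.
  - specialize (Hf O (le_n _)); simpl INR in *; simpl pow in *; nra.
  - eapply Rle_trans; [apply Cmod_triangle|].
    pose proof (IH f c ltac:(intros j Hj; apply Hf; lia)) as H1.
    pose proof (IH (fun j => f (S j)) (c - 2)%R) as H2.
    assert (H3 : forall j, (j <= n)%nat ->
      (Cmod (f (S j)) <= u + w * (2 * INR j - (c - 2)) ^ 2)%R).
    { intros j Hj; specialize (Hf (S j) ltac:(lia)); rewrite S_INR in Hf.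
      replace (2 * INR j - (c - 2))%R with (2 * (INR j + 1) - c)%R by ring; exact Hf. }
    specialize (H2 H3); rewrite S_INR.
    replace (2 ^ S n * (u + w * (INR n + 1 + (INR n + 1 - c) ^ 2)))%R with
      (2 ^ n * (u + w * (INR n + (INR n - c) ^ 2)) +
       2 ^ n * (u + w * (INR n + (INR n - (c - 2)) ^ 2)))%R by (simpl; ring).
    lra.
Qed.

(** The defect of [g] in its two-step recurrence, centred at [i]: it links the indices [i - 1] and
    [i + 1]. By [bt_recurrence], its transform is the defect of the transform of [g] in the
    three-term recurrence. *)
Definition bt_rec_symbol (al be b : C) (g : nat -> C) (i : nat) : C :=
  (INR i + 1 + al) * (INR i + 1 + be) * g (S i)
  - INR i * (INR i - 1 + 2 * b) * g (pred i).

(** All terms are brought to length [n], powers of [n] being moved inside by [bt_mul_length];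
    comparing coefficients dictates the symbol and the value of its last parameter. The leading
    factor stays undivided because it may vanish. *)
Lemma bt_recurrence (al be ga : C) (g : nat -> C) (n : nat) :
  (INR (S n) + al) * (INR (S n) + be) * bt (S n) g
  = H_a al be n * bt n g - 2 * INR n * (INR n + ga) * bt (pred n) g
    + bt n (bt_rec_symbol al be ((al + be + 1) / 2 - ga) g).
Proof.
  assert (Hm : INR n * bt (pred n) g = INR n * bt n g - bt n (fun j => INR j * g j)).
  { destruct n as [|n]; [simpl; ring|].
    rewrite bt_mul_index; simpl Nat.pred; ring. }
  replace (2 * INR n * (INR n + ga) * bt (pred n) g) with
    (2 * (INR n + ga) * (INR n * bt (pred n) g)) by ring.
  rewrite Hm.
  simpl bt at 1.
  pose (s := fun j => g (S j)); fold s.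
  assert (E1 : INR n * bt n s = bt n (fun j => INR j * (s j + g j))).
  { rewrite bt_mul_length; apply bt_ext; intros [|j] _; unfold s; simpl pred; [simpl; ring|reflexivity]. }
  assert (E2 : INR n * (INR n * bt n s) =
    bt n (fun j => INR j * (INR j * (s j + g j) + INR (pred j) * (g j + g (pred j))))).
  { rewrite E1, bt_mul_length; apply bt_ext; intros [|j] _; unfold s; simpl pred; [simpl; ring|reflexivity]. }
  pose proof (bt_mul_length n g) as E3.
  pose proof (bt_mul_length n (fun j => INR j * g j)) as E4.
  set (b := (al + be + 1) / 2 - ga).
  assert (Hb : ga = (al + be + 1) / 2 - b) by (unfold b; field).
  (* The symbol is polynomial in [j]; its transform is rewritten with powers of the length as
     multipliers. After [E1] to [E4] this is a termwise polynomial identity. *)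
  assert (Key : bt n (bt_rec_symbol al be b g) =
    INR n * (INR n * bt n s) + (2 + al + be) * (INR n * bt n s)
    + (1 + al) * (1 + be) * bt n s + (- 2 * b) * (INR n * bt n g)
    + (- 2) * (INR n * bt n (fun j => INR j * g j))
    + (- (al + be + 1 - 2 * b)) * bt n (fun j => INR j * g j)).
  { rewrite E2, E1, E3, E4, <- !bt_scal, <- !bt_plus; apply bt_ext.
    intros [|j] _; unfold bt_rec_symbol, s; simpl Nat.pred; [simpl; ring|].
    rewrite !INR_S_C; ring. }
  rewrite Key, Hb.
  unfold H_a, Defs.Delta; rewrite !INR_S_C; field.
Qed.

(** * The numerators as a binomial transform *)

Lemma two_step_ind (P : nat -> Prop) :
  P O -> P 1%nat -> (forall n, P n -> P (S (S n))) -> forall n, P n.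
Proof.
  intros H0 H1 HS n; assert (P n /\ P (S n)) as [H _]; [|exact H].
  induction n as [|n [IH1 IH2]]; split; auto.
Qed.

(** For even [p], the zero of [bt_rec_symbol al be b] supported on the
    indices [p], [p+2], [p+4] and so on, with value [1]
    at [p]; since [/ 0 = 0] it also vanishes from the next zero of
    [(j + al) * (j + be)] on. *)
Fixpoint bt_coef (al be b : C) (p : nat) (j : nat) : C :=
  match j with
  | O => if Nat.eqb p 0 then 1 else 0
  | S O => 0
  | S (S i) => if Nat.eqb p j then 1 else
      (INR i + 1) * (INR i + 2 * b) / ((INR j + al) * (INR j + be))
      * bt_coef al be b p i
  end.

(** The v_n of the overview, with factors only beyond [p], so that a zero factor at [p] is left
    out. *)
Fixpoint shifted_prod (al be : C) (p n : nat) : C :=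
  match n with
  | O => 1
  | S m => if Nat.leb n p then 1
           else (INR n + al) * (INR n + be) * shifted_prod al be p m
  end.

Lemma bt_coef_SS (al be b : C) (p i : nat) : p <> S (S i) ->
  bt_coef al be b p (S (S i)) =
  (INR i + 1) * (INR i + 2 * b) / ((INR (S (S i)) + al) * (INR (S (S i)) + be))
      * bt_coef al be b p i.
Proof.
  intros H; cbn [bt_coef]; apply Nat.eqb_neq in H; now rewrite H.
Qed.

Lemma bt_coef_odd (al be b : C) (p j : nat) :
  Nat.even p = true -> Nat.even j = false -> bt_coef al be b p j = 0.
Proof.
  intros Hp; revert j; apply (two_step_ind (fun j => Nat.even j = false -> _)).
  - discriminate.
  - reflexivity.
  - intros n IH Hn.
    rewrite bt_coef_SS by (intros ->; congruence).
    rewrite IH; [ring|exact Hn].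
Qed.

Lemma bt_coef_below (al be b : C) (p j : nat) : (j < p)%nat -> bt_coef al be b p j = 0.
Proof.
  revert j; apply (two_step_ind (fun j => (j < p)%nat -> _)).
  - destruct p; [lia|reflexivity].
  - reflexivity.
  - intros n IH Hn; rewrite bt_coef_SS, IH by lia; ring.
Qed.

Lemma bt_coef_start (al be b : C) (p : nat) :
  Nat.even p = true -> bt_coef al be b p p = 1.
Proof.
  destruct p as [|[|p]]; [reflexivity|discriminate|].
  intros _; cbn [bt_coef]; now rewrite Nat.eqb_refl.
Qed.

Lemma shifted_prod_start (al be : C) (p : nat) : shifted_prod al be p p = 1.
Proof. destruct p; [reflexivity|]; cbn [shifted_prod]; now rewrite Nat.leb_refl. Qed.

Lemma shifted_prod_S (al be : C) (p n : nat) : (p <= n)%nat ->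
  shifted_prod al be p (S n) =
  (INR (S n) + al) * (INR (S n) + be) * shifted_prod al be p n.
Proof.
  intros H; cbn [shifted_prod].
  now replace (Nat.leb (S n) p) with false by (symmetry; apply Nat.leb_gt; lia).
Qed.

Section Explicit.

Variables al be ga : C.
Let b := (al + be + 1) / 2 - ga.
Let A := CF_A (H_a al be) (H_b al be ga).

Definition degenerate (n : nat) : Prop := (INR n + al) * (INR n + be) = 0.

Lemma numerator_SS (n : nat) :
  A (S (S n)) = H_a al be (S n) * A (S n) + H_b al be ga (S n) * A n.
Proof. reflexivity. Qed.

(** One equation on [p] covers both possible starts, 0 and a degenerate index. The only nonzero
    coefficient that could enter is the one at [p], when [S i = p], and there its factor
    vanishes. *)
Lemma symbol_below (p i : nat) :
  Nat.even p = true -> INR p * ((INR p + al) * (INR p + be)) = 0 -> (S i <= p)%nat ->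
  bt_rec_symbol al be b (bt_coef al be b p) i = 0.
Proof.
  intros Hp Hd Hi; unfold bt_rec_symbol.
  rewrite (bt_coef_below al be b p (Nat.pred i)) by lia.
  destruct (Nat.eq_dec (S i) p) as [E|E].
  - subst p; rewrite INR_S_C in Hd.
    assert (Hz : INR i + 1 <> 0).
    { rewrite <- INR_S_C; intros H; apply RtoC_inj in H; now apply not_0_INR in H. }
    destruct (Ceq_dec ((INR i + 1 + al) * (INR i + 1 + be)) 0) as [E|E].
    + rewrite E; ring.
    + destruct (Cmult_neq_0 _ _ Hz E Hd).
  - rewrite (bt_coef_below al be b p (S i)) by lia; ring.
Qed.

Lemma symbol_above (p i : nat) :
  (p <= i)%nat -> ~ degenerate (S i) ->
  bt_rec_symbol al be b (bt_coef al be b p) i = 0.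
Proof.
  intros Hi Hd; unfold bt_rec_symbol, degenerate in *.
  destruct i as [|i]; [simpl; ring|].
  rewrite bt_coef_SS by lia; simpl Nat.pred.
  rewrite !INR_S_C in *; field.
  split; intros E; apply Hd; [rewrite E|rewrite E]; ring.
Qed.

Lemma symbol_zero (p i : nat) :
  Nat.even p = true -> INR p * ((INR p + al) * (INR p + be)) = 0 ->
  ((S i <= p)%nat \/ ~ degenerate (S i)) ->
  bt_rec_symbol al be b (bt_coef al be b p) i = 0.
Proof.
  intros Hp Hd H; destruct (Nat.le_gt_cases (S i) p).
  - now apply symbol_below.
  - destruct H; [lia|]; apply symbol_above; [lia|assumption].
Qed.

(** The product is taken at [n], not at [S n], so that the formula survives when [S n] is
    degenerate, where that of [numerator_explicit] would give zero. *)
Lemma numerator_step (p n : nat) :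
  Nat.even p = true -> INR p * ((INR p + al) * (INR p + be)) = 0 -> (p <= n)%nat ->
  (forall k, (p <= k <= n)%nat ->
     A k = A p * shifted_prod al be p k * bt k (bt_coef al be b p)) ->
  A (S n) = A p * shifted_prod al be p n *
    ((INR (S n) + al) * (INR (S n) + be) * bt (S n) (bt_coef al be b p)
     - bt n (bt_rec_symbol al be b (bt_coef al be b p))).
Proof.
  intros Hp Hd Hn IH.
  rewrite (bt_recurrence al be ga); fold b.
  destruct (Nat.eq_dec n p) as [->|Hne].
  - rewrite shifted_prod_start.
    assert (E : bt p (bt_coef al be b p) = 1).
    { rewrite bt_last; [now apply bt_coef_start|].
      intros; now apply bt_coef_below. }
    rewrite E; destruct p as [|p].
    + simpl INR; unfold A, CF_A; cbn [CF_rec]; ring.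
    + rewrite numerator_SS; simpl Nat.pred.
      assert (E0 : bt p (bt_coef al be b (S p)) = 0).
      { rewrite bt_last; [apply bt_coef_below; lia|].
        intros; apply bt_coef_below; lia. }
      (* Since [H_b] vanishes at the start, the recurrence forgets the earlier numerators and
         restarts proportionally to the one at the start. *)
      assert (E1 : H_b al be ga (S p) = 0).
      { transitivity (-(2) * (INR (S p) + ga) *
          (INR (S p) * ((INR (S p) + al) * (INR (S p) + be)))); [unfold H_b; ring|].
        rewrite Hd; ring. }
      rewrite E0, E1; ring.
  - destruct n as [|n]; [lia|].
    rewrite numerator_SS, (IH (S n)), (IH n) by lia; simpl Nat.pred.
    rewrite shifted_prod_S by lia; unfold H_b; ring.
Qed.

Lemma numerator_explicit (p m : nat) :
  Nat.even p = true -> INR p * ((INR p + al) * (INR p + be)) = 0 ->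
  (forall k, (p < k <= m)%nat -> ~ degenerate k) ->
  forall n, (p <= n <= m)%nat ->
  A n = A p * shifted_prod al be p n * bt n (bt_coef al be b p).
Proof.
  intros Hp Hd Hk.
  assert (H : forall d n, (n <= p + d)%nat -> (p <= n <= m)%nat ->
    A n = A p * shifted_prod al be p n * bt n (bt_coef al be b p)).
  2:{ intros n; apply (H n); lia. }
  induction d as [|d IH]; intros n Hn1 Hn2.
  - replace n with p by lia; rewrite shifted_prod_start, bt_last, bt_coef_start; trivial; [ring|].
    intros; now apply bt_coef_below.
  - destruct (Nat.le_gt_cases n (p + d)) as [H|H]; [apply IH; lia|].
    destruct n as [|n]; [lia|].
    rewrite (numerator_step p n); try assumption; try lia.
    2:{ intros; apply IH; lia. }
    rewrite (bt_last n).
    2:{ intros j Hj; apply symbol_zero; trivial.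
        destruct (Nat.le_gt_cases (S j) p); [left|right]; [lia|apply Hk; lia]. }
    rewrite symbol_zero; trivial; [|right; apply Hk; lia].
    rewrite shifted_prod_S by lia; ring.
Qed.

Hypothesis Hb : forall j : nat, Nat.even j = true -> INR j + 2 * b <> 0.
Hypothesis Hodd : forall n : nat, degenerate n -> Nat.even n = true.

Lemma bt_coef_neq_0 (p m : nat) :
  Nat.even p = true -> (forall k, (p < k <= m)%nat -> ~ degenerate k) ->
  forall j, (p <= j <= m)%nat -> Nat.even j = true -> bt_coef al be b p j <> 0.
Proof.
  intros Hp Hk; apply (two_step_ind (fun j => (p <= j <= m)%nat -> Nat.even j = true -> _)).
  - intros Hj _; replace p with O by lia; simpl; apply C1_nz.
  - discriminate.
  - intros n IH Hj Hn; simpl in Hn.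
    destruct (Nat.eq_dec (S (S n)) p) as [->|Hne].
    + rewrite bt_coef_start by assumption; apply C1_nz.
    + rewrite bt_coef_SS by lia.
      assert (p <> S n).
      { intros ->. rewrite Nat.even_succ, <- Nat.negb_even, Hn in Hp; discriminate. }
      apply Cmult_neq_0; [|apply IH; trivial; lia].
      apply Cmult_neq_0; [apply Cmult_neq_0; [|now apply Hb]|].
      * rewrite <- INR_S_C; intros E; apply RtoC_inj in E; now apply not_0_INR in E.
      * specialize (Hk (S (S n)) ltac:(lia)); intros E.
        apply C1_nz; rewrite <- (Cinv_r _ Hk), E; ring.
Qed.

Lemma shifted_prod_neq_0 (p m : nat) :
  (forall k, (p < k <= m)%nat -> ~ degenerate k) ->
  forall n, (n <= m)%nat -> shifted_prod al be p n <> 0.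
Proof.
  intros Hk; induction n as [|n IH]; intros Hn; [apply C1_nz|].
  destruct (Nat.le_gt_cases p n) as [H|H].
  - rewrite shifted_prod_S by assumption; apply Cmult_neq_0; [apply Hk; lia|apply IH; lia].
  - cbn [shifted_prod]; apply Nat.leb_le in H; rewrite H; apply C1_nz.
Qed.

(** At a degenerate [S m] the leading term drops out, and the symbol survives only at [m], where it
    is -m (m-1+2b) times the coefficient at m-1. As [S m] is even, so is m-1; hence neither m-1+2b
    nor that coefficient is zero. *)
Lemma numerator_next_degenerate (p m : nat) :
  Nat.even p = true -> INR p * ((INR p + al) * (INR p + be)) = 0 ->
  A p <> 0 -> (p <= m)%nat ->
  (forall k, (p < k <= m)%nat -> ~ degenerate k) -> degenerate (S m) ->
  A (S m) <> 0.
Proof.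
  intros Hp Hd HA Hm Hk Hdeg.
  pose proof (Hodd _ Hdeg) as He.
  assert (p <> m).
  { intros ->; rewrite Nat.even_succ, <- Nat.negb_even, Hp in He; discriminate. }
  rewrite (numerator_step p m); trivial.
  2:{ apply numerator_explicit; trivial. }
  rewrite Hdeg, (bt_last m).
  2:{ intros j Hj; apply symbol_zero; trivial.
      destruct (Nat.le_gt_cases (S j) p); [left|right]; [lia|apply Hk; lia]. }
  unfold bt_rec_symbol.
  destruct m as [|m]; [lia|]; simpl Nat.pred.
  rewrite Nat.even_succ_succ in He.
  assert (p <> S m).
  { intros ->. rewrite Nat.even_succ, <- Nat.negb_even, He in Hp; discriminate. }
  unfold degenerate in Hdeg; rewrite INR_S_C in Hdeg; rewrite Hdeg.
  replace (A p * shifted_prod al be p (S m) * (0 * bt (S (S m)) (bt_coef al be b p) -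
    (0 * bt_coef al be b p (S (S m)) -
      INR (S m) * (INR (S m) - 1 + 2 * b) * bt_coef al be b p m))) with
   (A p * shifted_prod al be p (S m) *
     (INR (S m) * (INR m + 2 * b) * bt_coef al be b p m)) by (rewrite INR_S_C; ring).
  repeat apply Cmult_neq_0; trivial.
  - now apply (shifted_prod_neq_0 p (S m)).
  - intros E; apply RtoC_inj in E; now apply not_0_INR in E.
  - now apply Hb.
  - apply (bt_coef_neq_0 p (S m)); trivial; lia.
Qed.

(** The search starts at 0 and jumps from one degenerate index to the next, carrying [A p <> 0]
    along. *)
Lemma last_degenerate (M : nat) : (forall n, degenerate n -> (n <= M)%nat) ->
  exists p, Nat.even p = true /\ INR p * ((INR p + al) * (INR p + be)) = 0 /\
    A p <> 0 /\ forall k, (p < k)%nat -> ~ degenerate k.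
Proof.
  intros HM.
  assert (H : forall d p, (M <= p + d)%nat -> Nat.even p = true ->
    INR p * ((INR p + al) * (INR p + be)) = 0 -> A p <> 0 ->
    exists p, Nat.even p = true /\ INR p * ((INR p + al) * (INR p + be)) = 0 /\
    A p <> 0 /\ forall k, (p < k)%nat -> ~ degenerate k).
  2:{ apply (H M O); trivial; [simpl; ring|apply C1_nz]. }
  induction d as [|d IH]; intros p Hpd Hp Hd HA.
  - exists p; repeat split; trivial; intros k Hk Hdeg; apply HM in Hdeg; lia.
  - destruct (classic (exists k, (p < k)%nat /\ degenerate k)) as [Hex|Hex].
    2:{ exists p; repeat split; trivial; intros k Hk Hdeg; apply Hex; now exists k. }
    destruct (dec_inh_nat_subset_has_unique_least_element
      (fun k => (p < k)%nat /\ degenerate k)) as [k [[[Hk1 Hk2] Hk3] _]]; trivial.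
    { intros; apply classic. }
    destruct k as [|k]; [lia|].
    apply (IH (S k)); [lia|now apply Hodd| |].
    + unfold degenerate in Hk2; rewrite Hk2; ring.
    + apply (numerator_next_degenerate p k); trivial; [lia|].
      intros i Hi Hdeg; specialize (Hk3 i (conj (proj1 Hi) Hdeg)); lia.
Qed.

End Explicit.

(** * Transforms of slowly varying sequences *)

Lemma Cmod_INR (n : nat) : Cmod (INR n) = INR n.
Proof. rewrite Cmod_R; apply Rabs_pos_eq, pos_INR. Qed.

Lemma Cmod_triangle_sub (x y : C) : (Cmod x <= Cmod y + Cmod (x - y))%R.
Proof.
  replace x with (y + (x - y)) at 1 by ring; apply Cmod_triangle.
Qed.

Lemma Cmod_sub_sym (x y : C) : Cmod (x - y) = Cmod (y - x).
Proof. rewrite <- Cmod_opp; f_equal; ring. Qed.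

Lemma telescope_bound (H : nat -> C) (L : R) (m : nat) :
  (forall k, (k < m)%nat -> (Cmod (H (S k) - H k) <= L)%R) ->
  forall i d, (i + d <= m)%nat -> (Cmod (H (i + d)%nat - H i) <= L * INR d)%R.
Proof.
  intros HL i; induction d as [|d IH]; intros Hd.
  - rewrite Nat.add_0_r; replace (H i - H i) with (RtoC 0) by ring.
    rewrite Cmod_0; simpl; lra.
  - rewrite Nat.add_succ_r, S_INR.
    replace (H (S (i + d)) - H i) with
      ((H (S (i + d)) - H (i + d)%nat) + (H (i + d)%nat - H i)) by ring.
    eapply Rle_trans; [apply Cmod_triangle|].
    specialize (IH ltac:(lia)); specialize (HL (i + d)%nat ltac:(lia)); lra.
Qed.

Lemma finite_bound (f : nat -> R) (n : nat) :
  exists B, (0 <= B)%R /\ forall k, (k < n)%nat -> (f k <= B)%R.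
Proof.
  induction n as [|n [B [HB IH]]]; [exists 0%R; split; [lra|intros; lia]|].
  exists (Rmax B (f n)); split; [eapply Rle_trans; [exact HB|apply Rmax_l]|].
  intros k Hk; destruct (Nat.eq_dec k n) as [->|]; [apply Rmax_r|].
  eapply Rle_trans; [apply IH; lia|apply Rmax_l].
Qed.

Section SlowlyVarying.

Variables (H : nat -> C) (k1 : nat) (C0 : R).
Hypothesis Hk1 : (1 <= k1)%nat.
Hypothesis HC0 : (0 <= C0)%R.
Hypothesis H_neq_0 : H k1 <> 0.
Hypothesis H_incr : forall k, (k1 <= k)%nat ->
  (Cmod (H (S k) - H k) <= C0 / INR k * Cmod (H k))%R.
Hypothesis H_grow : forall k, (k1 <= k)%nat ->
  (Cmod (H k) / INR k <= Cmod (H (S k)) / INR (S k))%R.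

Lemma slow_mono (k i : nat) : (k1 <= k)%nat -> (k <= i)%nat ->
  (Cmod (H k) / INR k <= Cmod (H i) / INR i)%R.
Proof.
  intros Hk Hi; induction Hi as [|i Hi IH]; [lra|].
  eapply Rle_trans; [exact IH|apply H_grow; lia].
Qed.

Lemma slow_upper (M i : nat) : (k1 <= M)%nat ->
  (Cmod (H (M + i)%nat) <= exp (C0 * (INR i / INR M)) * Cmod (H M))%R.
Proof.
  intros HM; assert (HM0 : (0 < INR M)%R) by (apply lt_0_INR; lia).
  induction i as [|i IH].
  - rewrite Nat.add_0_r; simpl INR; unfold Rdiv; rewrite Rmult_0_l, Rmult_0_r, exp_0; lra.
  - rewrite Nat.add_succ_r.
    eapply Rle_trans; [apply (Cmod_triangle_sub _ (H (M + i)%nat))|].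
    specialize (H_incr (M + i)%nat ltac:(lia)).
    assert (Hd : (C0 / INR (M + i) <= C0 / INR M)%R).
    { apply Rmult_le_compat_l; trivial; apply Rinv_le_contravar; trivial.
      apply le_INR; lia. }
    pose proof (Cmod_ge_0 (H (M + i)%nat)).
    assert (He : (1 + C0 / INR M <= exp (C0 / INR M))%R) by apply exp_ineq1_le.
    replace (C0 * (INR (S i) / INR M))%R with (C0 / INR M + C0 * (INR i / INR M))%R
      by (rewrite S_INR; field; lra).
    rewrite exp_plus, Rmult_assoc.
    assert (0 <= C0 / INR M)%R.
    { apply Rmult_le_pos; trivial; left; now apply Rinv_0_lt_compat. }
    apply Rle_trans with ((1 + C0 / INR M) * Cmod (H (M + i)%nat))%R; [nra|].
    apply Rmult_le_compat; trivial; lra.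
Qed.

(** An increment at [k] is at most [C0] times |H k|/k. By monotonicity this quotient is at most its
    value at 2M, which [slow_upper] compares with its value at M. The finitely many increments below
    [k1] are absorbed because |H M|/M is bounded below. *)
Lemma slow_lipschitz : exists C', (0 <= C')%R /\ forall M, (k1 <= M)%nat ->
  forall k, (k <= 2 * M)%nat ->
  (Cmod (H k - H M) <= C' * (Cmod (H M) / INR M) * Rabs (INR k - INR M))%R.
Proof.
  destruct (finite_bound (fun k => Cmod (H (S k) - H k)) k1) as [B [HB HBk]].
  assert (Hp : (0 < Cmod (H k1) / INR k1)%R).
  { apply Rdiv_lt_0_compat; [now apply Cmod_gt_0|apply lt_0_INR; lia]. }
  assert (He : (0 < exp C0)%R) by apply exp_pos.
  assert (HBp : (0 <= B / (Cmod (H k1) / INR k1))%R).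
  { apply Rmult_le_pos; trivial; left; now apply Rinv_0_lt_compat. }
  exists (C0 * exp C0 + B / (Cmod (H k1) / INR k1))%R; split; [nra|].
  intros M HM.
  assert (HM0 : (0 < INR M)%R) by (apply lt_0_INR; lia).
  set (a := (Cmod (H M) / INR M)%R).
  assert (Ha : (Cmod (H k1) / INR k1 <= a)%R) by (apply slow_mono; lia).
  set (L := ((C0 * exp C0 + B / (Cmod (H k1) / INR k1)) * a)%R).
  assert (HL : forall k, (k < 2 * M)%nat -> (Cmod (H (S k) - H k) <= L)%R).
  { intros k Hk; unfold L; rewrite Rmult_plus_distr_r.
    destruct (Nat.le_gt_cases k1 k) as [Hkk|Hkk].
    - assert (0 <= B / (Cmod (H k1) / INR k1) * a)%R by (apply Rmult_le_pos; lra).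
      eapply Rle_trans; [now apply H_incr|].
      assert (E1 : (Cmod (H k) / INR k <= Cmod (H (M + M)%nat) / INR (M + M))%R)
        by (apply slow_mono; lia).
      assert (E2 : (Cmod (H (M + M)%nat) / INR (M + M) <= exp C0 * a)%R).
      { pose proof (slow_upper M M HM) as U.
        replace (C0 * (INR M / INR M))%R with C0 in U by (field; lra).
        rewrite plus_INR; unfold a.
        apply (Rmult_le_reg_r (INR M + INR M)); [lra|].
        replace (Cmod (H (M + M)%nat) / (INR M + INR M) * (INR M + INR M))%R with
          (Cmod (H (M + M)%nat)) by (field; lra).
        replace (exp C0 * (Cmod (H M) / INR M) * (INR M + INR M))%R with
          (2 * (exp C0 * Cmod (H M)))%R by (field; lra).
        pose proof (Rmult_le_pos _ _ (Rlt_le _ _ He) (Cmod_ge_0 (H M))); lra. }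
      replace (C0 / INR k * Cmod (H k))%R with (C0 * (Cmod (H k) / INR k))%R
        by (unfold Rdiv; ring).
      assert (C0 * (Cmod (H k) / INR k) <= C0 * (exp C0 * a))%R
        by (apply Rmult_le_compat_l; lra).
      lra.
    - eapply Rle_trans; [now apply HBk|].
      assert (0 <= C0 * exp C0 * a)%R by (apply Rmult_le_pos; [apply Rmult_le_pos; lra|lra]).
      assert (B <= B / (Cmod (H k1) / INR k1) * a)%R; [|lra].
      replace B with (B / (Cmod (H k1) / INR k1) * (Cmod (H k1) / INR k1))%R at 1
        by (field; split; [apply not_0_INR; lia| intros E; rewrite E in Hp; unfold Rdiv in Hp; lra]).
      apply Rmult_le_compat_l; lra. }
  intros k Hk; fold L.
  destruct (Nat.le_gt_cases k M) as [Hkm|Hkm].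
  - pose proof (telescope_bound H L (2 * M) HL k (M - k) ltac:(lia)) as T.
    replace (k + (M - k))%nat with M in T by lia.
    rewrite Cmod_sub_sym, Rabs_minus_sym, Rabs_pos_eq.
    + now rewrite minus_INR in T by lia.
    + apply le_INR in Hkm; lra.
  - pose proof (telescope_bound H L (2 * M) HL M (k - M) ltac:(lia)) as T.
    replace (M + (k - M))%nat with k in T by lia.
    rewrite Rabs_pos_eq.
    + now rewrite minus_INR in T by lia.
    + apply lt_INR in Hkm; lra.
Qed.

(** The binomial weights concentrate at [j = 2 M], where [h] varies slowly;
    the deviation is controlled by the variance of the binomial law. *)
Lemma bt_slow_lower (h : nat -> C) :
  (forall j, Nat.even j = false -> h j = 0) -> (forall k, h (2 * k)%nat = H k) ->
  exists (c : R) (M1 : nat), (0 < c)%R /\ forall M, (M1 <= M)%nat ->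
    (c * 2 ^ (4 * M) <= Cmod (bt (4 * M) h))%R.
Proof.
  intros Hodd Heven.
  destruct slow_lipschitz as [C' [HC' HL]].
  (* With this [eps] and [M >= C' / eps], each of the two error terms below is at most 2^(4M) a M /
     8, against a main term of 2^(4M) a M / 2. *)
  set (eps := (/ (4 * (C' + 1)))%R).
  assert (Heps : (0 < eps)%R) by (apply Rinv_0_lt_compat; lra).
  destruct (INR_unbounded (C' / eps)) as [M2 HM2].
  assert (Hp : (0 < Cmod (H k1) / INR k1)%R).
  { apply Rdiv_lt_0_compat; [now apply Cmod_gt_0|apply lt_0_INR; lia]. }
  exists (Cmod (H k1) / INR k1 / 4)%R, (k1 + M2)%nat; split; [lra|].
  intros M HM.
  assert (HM1 : (1 <= INR M)%R) by (change 1%R with (INR 1); apply le_INR; lia).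
  assert (HMM : (C' / eps <= INR M)%R).
  { apply Rle_trans with (INR M2); [lra|apply le_INR; lia]. }
  set (a := (Cmod (H M) / INR M)%R).
  assert (Ha : (Cmod (H k1) / INR k1 <= a)%R) by (apply slow_mono; lia).
  assert (Ha2 : Cmod (H M) = (a * INR M)%R) by (unfold a; field; lra).
  (* This is [h] frozen at the mean [j = 2 M]; the length [4 * M] is chosen to make the mean an even
     index. *)
  pose (chi := fun j => if Nat.even j then H M else 0).
  assert (Hchi : bt (4 * M) chi = 2 ^ (4 * M - 1) * H M).
  { replace (4 * M)%nat with (S (4 * M - 1)) at 1 by lia.
    unfold chi; rewrite bt_parity; ring. }
  assert (Hdiff : (Cmod (bt (4 * M) (fun j => (h j + (-(1)) * chi j)%C)) <=
    2 ^ (4 * M) * (C' * a * eps * INR M / 2 + C' * a / (32 * (eps * INR M)) *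
      (INR (4 * M) + (INR (4 * M) - INR (4 * M)) ^ 2)))%R).
  { apply bt_bound_square; intros j Hj.
    assert (Hem : (0 < eps * INR M)%R) by nra.
    (* The inequality |t| <= s/2 + t^2/(2s) with s = eps M turns the Lipschitz bound into the
       quadratic one that [bt_bound_square] accepts. For t = k - M and j = 2k, [4 * t] is 2j -
       4M. *)
    assert (Hsq : forall t, (C' * a * Rabs t <=
       C' * a * eps * INR M / 2 + C' * a / (32 * (eps * INR M)) * (4 * t) ^ 2)%R).
    { intros t.
      assert (Ht : (Rabs t * Rabs t = t * t)%R) by (rewrite <- Rabs_mult; apply Rabs_pos_eq; nra).
      set (s := (eps * INR M)%R) in *.
      replace (C' * a * eps * INR M / 2 + C' * a / (32 * s) * (4 * t) ^ 2)%R with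
        (C' * a * (s / 2 + t * t / (2 * s)))%R by (unfold s; field; lra).
      apply Rmult_le_compat_l; [nra|].
      rewrite <- Ht.
      assert (E : (s / 2 + Rabs t * Rabs t / (2 * s) - Rabs t = (Rabs t - s) ^ 2 / (2 * s))%R)
        by (field; lra).
      assert (0 <= (Rabs t - s) ^ 2 / (2 * s))%R.
      { apply Rmult_le_pos; [apply pow2_ge_0|left; apply Rinv_0_lt_compat; lra]. }
      lra. }
    unfold chi; destruct (Nat.even j) eqn:Ej.
    - apply Nat.even_spec in Ej; destruct Ej as [k ->].
      rewrite Heven; replace (H k + - (1) * H M) with (H k - H M) by ring.
      eapply Rle_trans; [apply HL; lia|]; fold a.
      eapply Rle_trans; [apply Hsq|].
      rewrite !mult_INR; simpl (INR 2); simpl (INR 4).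
      right; f_equal; f_equal; ring.
    - rewrite (Hodd _ Ej); replace (0 + - (1) * 0) with (RtoC 0) by ring.
      rewrite Cmod_0; eapply Rle_trans; [|apply (Rplus_le_compat_l _ 0)].
      + rewrite Rplus_0_r; assert (0 <= C' * a)%R by (apply Rmult_le_pos; lra); nra.
      + apply Rmult_le_pos; [|apply pow2_ge_0].
        apply Rmult_le_pos; [nra|left; apply Rinv_0_lt_compat; lra]. }
  rewrite bt_plus, bt_scal, Hchi in Hdiff.
  assert (Hmain : (Cmod (2 ^ (4 * M - 1) * H M) = 2 ^ (4 * M) / 2 * (a * INR M))%R).
  { rewrite Cmod_mult, Cmod_pow, Cmod_R, Rabs_pos_eq by lra; rewrite Ha2.
    replace (4 * M)%nat with (S (4 * M - 1)) at 2 by lia; simpl pow; field. }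
  set (P := (2 ^ (4 * M))%R) in *.
  assert (HP : (0 < P)%R) by (apply pow_lt; lra).
  assert (Herr : (P * (C' * a * eps * INR M / 2 + C' * a / (32 * (eps * INR M)) *
      (INR (4 * M) + (INR (4 * M) - INR (4 * M)) ^ 2)) <= P * (a * INR M / 4))%R).
  { apply Rmult_le_compat_l; [lra|].
    rewrite mult_INR; simpl (INR 4).
    replace (C' * a * eps * INR M / 2 + C' * a / (32 * (eps * INR M)) *
      ((1 + 1 + 1 + 1) * INR M + ((1 + 1 + 1 + 1) * INR M - (1 + 1 + 1 + 1) * INR M) ^ 2))%R with
      (a * (C' * eps * INR M / 2 + (C' / eps) / 8))%R by (field; lra).
    replace (a * INR M / 4)%R with (a * (INR M / 4))%R by field.
    apply Rmult_le_compat_l; [lra|].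
    assert (E : (C' * eps <= / 4)%R).
    { unfold eps; replace (/ 4)%R with ((C' + 1) * / (4 * (C' + 1)))%R by (field; lra).
      apply Rmult_le_compat_r; [fold eps; lra|lra]. }
    nra. }
  pose proof (Cmod_triangle_sub (2 ^ (4 * M - 1) * H M) (- (bt (4 * M) h + - (1) * (2 ^ (4 * M - 1) * H M)))) as T.
  replace (2 ^ (4 * M - 1) * H M - - (bt (4 * M) h + - (1) * (2 ^ (4 * M - 1) * H M)))
    with (bt (4 * M) h) in T by ring.
  rewrite Cmod_opp, Hmain in T.
  assert (E3 : (Cmod (H k1) / INR k1 / 4 * P <= P * (a * INR M / 4))%R).
  { replace (Cmod (H k1) / INR k1 / 4 * P)%R with (P * (Cmod (H k1) / INR k1 / 4))%R by ring.
    apply Rmult_le_compat_l; [lra|nra]. }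
  lra.
Qed.

End SlowlyVarying.

(** * Polynomial weights and the growth of transforms *)

Lemma pow_one_plus_upper (x : R) (r : nat) :
  (0 <= x <= 1)%R -> ((1 + x) ^ r <= 1 + (2 ^ r - 1) * x)%R.
Proof.
  intros Hx; induction r as [|r IH]; simpl; [lra|].
  assert (1 <= 2 ^ r)%R by (apply pow_R1_Rle; lra).
  apply Rle_trans with ((1 + x) * (1 + (2 ^ r - 1) * x))%R; [apply Rmult_le_compat_l; lra|].
  assert ((2 ^ r - 1) * (x * x) <= (2 ^ r - 1) * x)%R by (apply Rmult_le_compat_l; nra).
  lra.
Qed.

Lemma bernoulli (x : R) (n : nat) : (0 <= x)%R -> (1 + INR n * x <= (1 + x) ^ n)%R.
Proof.
  intros [H|<-]; [now apply poly|]; rewrite Rplus_0_r, pow1; lra.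
Qed.

(** Every base above [t] is allowed, so that polynomial factors do not matter. *)
Definition bt_growth (t : R) (f : nat -> C) : Prop :=
  forall th, (t < th)%R -> exists K, (0 <= K)%R /\ forall n, (Cmod (bt n f) <= K * th ^ n)%R.

(** The factor n produced by [bt_mul_index] is absorbed by enlarging the base, through n x <=
    (1+x)^n. *)
Lemma bt_growth_mul_index (t : R) (f : nat -> C) : (1 <= t)%R ->
  bt_growth t f -> bt_growth t (fun j => INR j * f j).
Proof.
  intros Ht Hf th Hth.
  set (th' := ((th + t) / 2)%R).
  destruct (Hf th') as [K [HK HKn]]; [unfold th'; lra|].
  set (x := (th / th' - 1)%R).
  assert (Hth' : (1 <= th')%R) by (unfold th'; lra).
  assert (Hx : (0 < x)%R).
  { unfold x; replace (th / th' - 1)%R with ((th - th') / th')%R by (field; lra).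
    apply Rdiv_lt_0_compat; unfold th' in *; lra. }
  assert (HKx : (0 <= 2 * K / x)%R).
  { apply Rmult_le_pos; [lra|left; now apply Rinv_0_lt_compat]. }
  exists (2 * K / x)%R; split; [exact HKx|].
  intros [|n].
  - simpl bt; rewrite Cmult_0_l, Cmod_0; simpl; lra.
  - rewrite bt_mul_index, Cmod_mult, Cmod_INR.
    assert (E : (Cmod (bt (S n) f - bt n f) <= 2 * K * th' ^ S n)%R).
    { eapply Rle_trans; [apply Cmod_triangle|]; rewrite Cmod_opp.
      pose proof (HKn (S n)); pose proof (HKn n).
      assert (0 <= K * th' ^ n)%R by (apply Rmult_le_pos; [lra|apply pow_le; lra]).
      assert (K * th' ^ n <= K * th' ^ S n)%R.
      { simpl; nra. }
      lra. }
    apply Rle_trans with (INR (S n) * (2 * K * th' ^ S n))%R.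
    { apply Rmult_le_compat_l; [apply pos_INR|exact E]. }
    pose proof (bernoulli x (S n) ltac:(lra)) as B.
    assert (Eth : (th ^ S n = th' ^ S n * (1 + x) ^ S n)%R).
    { rewrite <- Rpow_mult_distr; f_equal; unfold x; field; lra. }
    rewrite Eth.
    replace (INR (S n) * (2 * K * th' ^ S n))%R with
      (2 * K / x * (th' ^ S n * (INR (S n) * x)))%R by (field; lra).
    apply Rmult_le_compat_l; [exact HKx|].
    apply Rmult_le_compat_l; [apply pow_le; lra|lra].
Qed.

Lemma bt_growth_mul_index_pow (t : R) (f : nat -> C) (r : nat) : (1 <= t)%R ->
  bt_growth t f -> bt_growth t (fun j => INR j ^ r * f j).
Proof.
  intros Ht Hf; induction r as [|r IH].
  - intros th Hth; destruct (Hf th Hth) as [K [HK HKn]]; exists K; split; trivial.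
    intros n; rewrite (bt_ext n _ f); [apply HKn|]; intros; simpl; ring.
  - apply bt_growth_mul_index in IH; trivial.
    intros th Hth; destruct (IH th Hth) as [K [HK HKn]]; exists K; split; trivial.
    intros n; specialize (HKn n).
    rewrite (bt_ext n _ (fun j => INR j * (INR j ^ r * f j))); [exact HKn|].
    intros; simpl; ring.
Qed.

Section NotSubdominant.

Variables (al be b : C) (g : nat -> C) (k0 : nat).
Hypothesis g_odd : forall j, Nat.even j = false -> g j = 0.
Hypothesis g_neq_0 : forall k, (k0 <= k)%nat -> g (2 * k)%nat <> 0.
Hypothesis g_rec : forall k, (k0 <= k)%nat ->
  (2 * INR k + 2 + al) * (2 * INR k + 2 + be) * g (2 * S k)%nat =
  (2 * INR k + 1) * (2 * INR k + 2 * b) * g (2 * k)%nat.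

(** Subtracting the two quadratics of the recurrence cancels 4k^2 and leaves O(k). For k above |al|
    + |be| the factors 2k+2+al and 2k+2+be have modulus at least k. *)
Lemma coef_slow : exists (C1 : R) (k1 : nat), (0 <= C1)%R /\ (1 <= k1)%nat /\ (k0 <= k1)%nat /\
  forall k, (k1 <= k)%nat ->
  (Cmod (g (2 * S k)%nat - g (2 * k)%nat) <= C1 / INR k * Cmod (g (2 * k)%nat))%R.
Proof.
  destruct (INR_unbounded (Cmod al + Cmod be)) as [k1 Hk1].
  set (C1 := (2 * Cmod (2 * b - 3 - al - be) + Cmod (2 * b - (2 + al) * (2 + be)))%R).
  assert (HC1 : (0 <= C1)%R).
  { unfold C1; pose proof (Cmod_ge_0 (2 * b - 3 - al - be));
    pose proof (Cmod_ge_0 (2 * b - (2 + al) * (2 + be))); lra. }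
  exists C1, (S (k0 + k1)); repeat split; try lia; trivial.
  intros k Hk.
  assert (Hk' : (1 <= INR k)%R) by (change 1%R with (INR 1); apply le_INR; lia).
  assert (Hkk : (Cmod al + Cmod be <= INR k)%R).
  { apply Rle_trans with (INR k1); [lra|apply le_INR; lia]. }
  pose proof (Cmod_ge_0 al); pose proof (Cmod_ge_0 be).
  assert (Hlow : forall z, (Cmod z <= INR k)%R -> (INR k <= Cmod (2 * INR k + 2 + z))%R).
  { intros z Hz.
    pose proof (Cmod_triangle_sub (2 * INR k + 2) (- z)) as T.
    replace (2 * INR k + 2 - - z) with (2 * INR k + 2 + z) in T by ring.
    rewrite Cmod_opp in T.
    replace (2 * INR k + 2) with (RtoC (2 * INR k + 2)) in T at 1
      by (rewrite RtoC_plus, RtoC_mult; ring).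
    rewrite Cmod_R, Rabs_pos_eq in T by lra; lra. }
  pose proof (Hlow al ltac:(lra)) as La; pose proof (Hlow be ltac:(lra)) as Lb.
  set (d := g (2 * S k)%nat - g (2 * k)%nat).
  assert (E : (2 * INR k + 2 + al) * (2 * INR k + 2 + be) * d =
    (2 * INR k * (2 * b - 3 - al - be) + (2 * b - (2 + al) * (2 + be))) * g (2 * k)%nat).
  { unfold d; transitivity ((2 * INR k + 2 + al) * (2 * INR k + 2 + be) * g (2 * S k)%nat
      - (2 * INR k + 2 + al) * (2 * INR k + 2 + be) * g (2 * k)%nat); [ring|].
    rewrite g_rec by lia; ring. }
  apply (f_equal Cmod) in E; rewrite !Cmod_mult in E.
  assert (E2 : (Cmod (2 * INR k * (2 * b - 3 - al - be) + (2 * b - (2 + al) * (2 + be)))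
    <= INR k * C1)%R).
  { eapply Rle_trans; [apply Cmod_triangle|].
    rewrite !Cmod_mult, Cmod_INR, Cmod_R, Rabs_pos_eq by lra; unfold C1.
    pose proof (Cmod_ge_0 (2 * b - (2 + al) * (2 + be))); nra. }
  pose proof (Cmod_ge_0 d); pose proof (Cmod_ge_0 (g (2 * k)%nat)).
  apply (Rmult_le_reg_l (INR k * INR k)); [nra|].
  replace (INR k * INR k * (C1 / INR k * Cmod (g (2 * k)%nat)))%R with
    (INR k * C1 * Cmod (g (2 * k)%nat))%R by (field; lra).
  apply Rle_trans with (Cmod (2 * INR k + 2 + al) * Cmod (2 * INR k + 2 + be) * Cmod d)%R.
  - apply Rmult_le_compat_r; trivial; apply Rmult_le_compat; lra.
  - rewrite E; now apply Rmult_le_compat_r.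
Qed.

(** From k to k+1, |g| is multiplied by at least 1 - C1/k and the weight by (1+1/k)^r. With r = m+1,
    one factor pays for the division by k; the others give at least 1 + m/k, which outweighs 1 -
    C1/k once m >= 2 C1 and k >= m. *)
Lemma weighted_slow : exists (r : nat) (C0 : R) (k1 : nat), (1 <= k1)%nat /\ (0 <= C0)%R /\
  let H := fun k : nat => (INR (2 * k)) ^ r * g (2 * k)%nat in
  H k1 <> 0 /\
  (forall k, (k1 <= k)%nat -> (Cmod (H (S k) - H k) <= C0 / INR k * Cmod (H k))%R) /\
  (forall k, (k1 <= k)%nat -> (Cmod (H k) / INR k <= Cmod (H (S k)) / INR (S k))%R).
Proof.
  destruct coef_slow as [C1 [k1 [HC1 [Hk1 [Hk01 Hslow]]]]].
  destruct (INR_unbounded (2 * C1)) as [m Hm].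
  (* The summand [C1] pays for the increment of [g], the weight growing at most by 2^r; the summand
     1 pays for the increment of the weight, as (1+1/k)^r - 1 <= 2^r/k. *)
  exists (S m), (2 ^ S m * (C1 + 1))%R, (k1 + m)%nat.
  assert (Hr1 : (1 <= 2 ^ S m)%R) by (apply pow_R1_Rle; lra).
  split; [lia|]; split; [nra|]; intros H.
  assert (HH : forall k, Cmod (H k) = ((2 * INR k) ^ S m * Cmod (g (2 * k)%nat))%R).
  { intros k; unfold H; rewrite Cmod_mult, Cmod_pow, Cmod_INR, mult_INR; reflexivity. }
  split; [|split].
  - unfold H; apply Cmult_neq_0; [|apply g_neq_0; lia].
    apply Cpow_nz; intros E; apply RtoC_inj in E; apply not_0_INR in E; [easy|lia].
  - intros k Hk; rewrite HH.
    assert (Hk' : (1 <= INR k)%R) by (change 1%R with (INR 1); apply le_INR; lia).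
    specialize (Hslow k ltac:(lia)).
    replace (H (S k) - H k) with
      (INR (2 * S k) ^ S m * (g (2 * S k)%nat - g (2 * k)%nat) +
       RtoC (INR (2 * S k) ^ S m - INR (2 * k) ^ S m) * g (2 * k)%nat)
      by (unfold H; rewrite RtoC_minus, !RtoC_pow; ring).
    eapply Rle_trans; [apply Cmod_triangle|].
    rewrite !Cmod_mult, Cmod_pow, Cmod_INR, Cmod_R.
    assert (E : (INR (2 * S k) = INR (2 * k) * (1 + / INR k))%R).
    { rewrite !mult_INR, (S_INR k); field; lra. }
    assert (Hx : (0 <= / INR k <= 1)%R).
    { split; [left; apply Rinv_0_lt_compat; lra|].
      rewrite <- Rinv_1; apply Rinv_le_contravar; lra. }
    rewrite E, Rpow_mult_distr.
    pose proof (pow_one_plus_upper _ (S m) Hx) as U.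
    assert (U1 : (1 <= (1 + / INR k) ^ S m)%R) by (apply pow_R1_Rle; lra).
    assert (EP : INR (2 * k) = (2 * INR k)%R) by (rewrite mult_INR; reflexivity).
    rewrite EP.
    set (P := ((2 * INR k) ^ S m)%R) in *.
    assert (HP : (0 < P)%R) by (apply pow_lt; lra).
    set (Q := ((1 + / INR k) ^ S m)%R) in *.
    set (T := (2 ^ S m)%R) in *.
    replace (P * Q - P)%R with (P * (Q - 1))%R by ring.
    rewrite (Rabs_pos_eq (P * (Q - 1))) by (apply Rmult_le_pos; lra).
    set (G := Cmod (g (2 * k)%nat)) in *.
    assert (HG : (0 <= G)%R) by apply Cmod_ge_0.
    assert (HQT : (Q <= T)%R) by nra.
    assert (A1 : (P * Q * Cmod (g (2 * S k)%nat - g (2 * k)%nat) <= P * T * (C1 / INR k * G))%R).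
    { apply Rmult_le_compat; [apply Rmult_le_pos; lra|apply Cmod_ge_0| |exact Hslow].
      apply Rmult_le_compat_l; lra. }
    assert (A2 : (P * (Q - 1) * G <= P * (T * / INR k) * G)%R).
    { apply Rmult_le_compat_r; trivial; apply Rmult_le_compat_l; nra. }
    replace (T * (C1 + 1) / INR k * (P * G))%R with
     (P * T * (C1 / INR k * G) + P * (T * / INR k) * G)%R by (field; lra).
    lra.
  - intros k Hk; rewrite !HH.
    assert (Hk' : (1 <= INR k)%R) by (change 1%R with (INR 1); apply le_INR; lia).
    specialize (Hslow k ltac:(lia)).
    rewrite Cmod_sub_sym in Hslow.
    pose proof (Cmod_triangle_sub (g (2 * k)%nat) (g (2 * S k)%nat)) as T.
    set (G := Cmod (g (2 * k)%nat)) in *; set (G' := Cmod (g (2 * S k)%nat)) in *.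
    assert (HG : (0 <= G)%R) by apply Cmod_ge_0.
    set (x := (/ INR k)%R).
    assert (Hx : (0 < x <= 1)%R).
    { split; [apply Rinv_0_lt_compat; lra|].
      unfold x; rewrite <- Rinv_1; apply Rinv_le_contravar; lra. }
    assert (HG' : ((1 - C1 * x) * G <= G')%R).
    { unfold Rdiv in Hslow; fold x in Hslow; lra. }
    assert (HmI : (INR m * x <= 1)%R).
    { unfold x; apply (Rmult_le_reg_r (INR k)); [lra|].
      rewrite Rmult_assoc, Rinv_l, Rmult_1_r, Rmult_1_l by lra; apply le_INR; lia. }
    assert (Hone : (1 <= (1 + INR m * x) * (1 - C1 * x))%R).
    { assert (0 <= x * (INR m - C1 - C1 * (INR m * x)))%R; [|lra].
      apply Rmult_le_pos; nra. }
    pose proof (bernoulli x m ltac:(lra)) as B.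
    rewrite S_INR.
    replace (2 * (INR k + 1))%R with (2 * INR k * (1 + x))%R by (unfold x; field; lra).
    rewrite (Rpow_mult_distr (2 * INR k) (1 + x)).
    set (P := ((2 * INR k) ^ S m)%R) in *.
    assert (HP : (0 < P)%R) by (apply pow_lt; lra).
    replace (P * (1 + x) ^ S m * G' / (INR k + 1))%R with (P * x * ((1 + x) ^ m * G'))%R
      by (simpl pow; unfold x; field; lra).
    replace (P * G / INR k)%R with (P * x * G)%R by (unfold x; field; lra).
    apply Rmult_le_compat_l; [apply Rmult_le_pos; lra|].
    assert (HC1x : (0 < 1 - C1 * x)%R).
    { assert (0 <= INR m * x)%R by (apply Rmult_le_pos; [apply pos_INR|lra]); nra. }
    apply Rle_trans with ((1 + INR m * x) * ((1 - C1 * x) * G))%R; [nra|].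
    assert (0 <= INR m * x)%R by (apply Rmult_le_pos; [apply pos_INR|lra]).
    apply Rmult_le_compat; [lra|nra|lra|lra].
Qed.

Lemma bt_not_small (K : R) : ~ (forall n, (Cmod (bt n g) <= K * (6 / 5) ^ n)%R).
Proof.
  intros HK.
  destruct weighted_slow as [r [C0 [k1 [Hk1 [HC0 [Hne [Hincr Hgrow]]]]]]].
  destruct (bt_slow_lower _ k1 C0 Hk1 HC0 Hne Hincr Hgrow (fun j => INR j ^ r * g j))
    as [c [M1 [Hc HM1]]].
  { intros j Hj; rewrite g_odd by assumption; ring. }
  { reflexivity. }
  assert (Hg : bt_growth (6 / 5) g).
  { intros th Hth; exists (Rmax K 0); split; [apply Rmax_r|].
    intros n; eapply Rle_trans; [apply HK|].
    assert (0 <= (6 / 5) ^ n)%R by (apply pow_le; lra).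
    assert ((6 / 5) ^ n <= th ^ n)%R by (apply pow_incr; lra).
    pose proof (Rmax_l K 0); pose proof (Rmax_r K 0); nra. }
  apply (bt_growth_mul_index_pow _ _ r) in Hg; [|lra].
  destruct (Hg (3 / 2)%R ltac:(lra)) as [K' [HK' HKn]].
  destruct (INR_unbounded (K' / c * 3)) as [M2 HM2].
  set (M := (M1 + M2)%nat).
  specialize (HM1 M ltac:(lia)); specialize (HKn (4 * M)%nat).
  assert (E : (c * 2 ^ (4 * M) <= K' * (3 / 2) ^ (4 * M))%R) by lra.
  assert (E2 : (2 ^ (4 * M) = (3 / 2) ^ (4 * M) * (1 + / 3) ^ (4 * M))%R).
  { rewrite <- Rpow_mult_distr; f_equal; field. }
  pose proof (bernoulli (/ 3) (4 * M) ltac:(lra)) as B.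
  set (P := ((3 / 2) ^ (4 * M))%R) in *.
  assert (HP : (0 < P)%R) by (apply pow_lt; lra).
  assert (E3 : (c * (1 + / 3) ^ (4 * M) <= K')%R).
  { apply (Rmult_le_reg_l P); trivial; rewrite E2 in E; lra. }
  assert (E4 : (INR M2 <= INR (4 * M))%R) by (apply le_INR; unfold M; lia).
  assert (E5 : (K' < c * (INR M2 * / 3))%R).
  { apply (Rmult_lt_reg_l (/ c)); [now apply Rinv_0_lt_compat|].
    rewrite <- Rmult_assoc, Rinv_l, Rmult_1_l by lra.
    replace (/ c * K')%R with (K' / c)%R by (unfold Rdiv; ring); lra. }
  nra.
Qed.

End NotSubdominant.

(** * The numerators are not subdominant *)

Lemma INR_mul_C (m n : nat) : RtoC (INR (m * n)) = INR m * INR n.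
Proof. now rewrite mult_INR, RtoC_mult. Qed.

Lemma INR_2_C : RtoC (INR 2) = 2.
Proof. reflexivity. Qed.

(** The equation (z+1)/2 = -k means z = -(2k+1). *)
Lemma odd_shift_neq_0 (z : C) (n : nat) :
  ~ nonpos_int ((z + 1) / 2) -> Nat.even n = false -> INR n + z <> 0.
Proof.
  intros Hz Hn E; apply Hz.
  destruct (Nat.Even_or_Odd n) as [He|[k ->]].
  - apply Nat.even_spec in He; congruence.
  - exists k; replace z with (- INR (2 * k + 1)).
    + rewrite plus_INR, RtoC_plus, INR_mul_C, INR_2_C; change (INR 1) with 1%R; field.
    + rewrite <- (Cplus_0_r (- INR (2 * k + 1))), <- E; ring.
Qed.

Lemma degenerate_even (al be : C) (n : nat) :
  ~ nonpos_int ((al + 1) / 2) -> ~ nonpos_int ((be + 1) / 2) ->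
  degenerate al be n -> Nat.even n = true.
Proof.
  intros Ha Hb Hd; destruct (Nat.even n) eqn:E; trivial.
  now destruct (Cmult_neq_0 _ _ (odd_shift_neq_0 _ _ Ha E) (odd_shift_neq_0 _ _ Hb E)).
Qed.

Lemma even_shift_neq_0 (b : C) (j : nat) :
  ~ nonpos_int b -> Nat.even j = true -> INR j + 2 * b <> 0.
Proof.
  intros Hb Hj E; apply Hb; apply Nat.even_spec in Hj; destruct Hj as [k ->]; exists k.
  rewrite INR_mul_C, INR_2_C in E.
  replace b with ((2 * INR k + 2 * b) / 2 - INR k) by field; rewrite E; field.
Qed.

Lemma degenerate_bounded (al be : C) :
  exists M, forall n, degenerate al be n -> (n <= M)%nat.
Proof.
  destruct (INR_unbounded (Cmod al + Cmod be)) as [M HM]; exists M.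
  intros n Hd; destruct (Nat.le_gt_cases n M) as [H|H]; trivial; exfalso.
  apply lt_INR in H.
  pose proof (Cmod_ge_0 al); pose proof (Cmod_ge_0 be).
  assert (Hz : forall z, (Cmod z <= INR M)%R -> INR n + z <> 0).
  { intros z Hz E.
    assert (E2 : z = - INR n) by (rewrite <- (Cplus_0_r (- INR n)), <- E; ring).
    rewrite E2, Cmod_opp, Cmod_INR in Hz; lra. }
  apply (Cmult_neq_0 _ _ (Hz al ltac:(lra)) (Hz be ltac:(lra)) Hd).
Qed.

Lemma shifted_prod_lower (al be : C) (p : nat) :
  (forall k, (p < k)%nat -> ~ degenerate al be k) ->
  exists (c : R) (n1 : nat), (0 < c)%R /\ (p <= n1)%nat /\ forall n, (n1 <= n)%nat ->
    (c * (9 / 10) ^ n * INR (fact n) ^ 2 <= Cmod (shifted_prod al be p n))%R.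
Proof.
  intros Hk.
  (* Beyond this threshold each factor has modulus at least 19/20 of its index, and (19/20)^2 >
     9/10. *)
  destruct (INR_unbounded (20 * (Cmod al + Cmod be))) as [N HN].
  set (n1 := (p + N)%nat).
  assert (Hn1 : (0 < Cmod (shifted_prod al be p n1))%R).
  { apply Cmod_gt_0, (shifted_prod_neq_0 _ _ p n1); trivial; intros; apply Hk; lia. }
  set (d := ((9 / 10) ^ n1 * INR (fact n1) ^ 2)%R).
  assert (Hd : (0 < d)%R).
  { apply Rmult_lt_0_compat; apply pow_lt; [lra|apply lt_0_INR, lt_O_fact]. }
  exists (Cmod (shifted_prod al be p n1) / d)%R, n1.
  split; [now apply Rdiv_lt_0_compat|]; split; [unfold n1; lia|].
  intros n Hn; induction Hn as [|n Hn IH].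
  - fold d; right; rewrite Rmult_assoc; fold d; field; lra.
  - rewrite shifted_prod_S by (unfold n1 in Hn; lia).
    rewrite !Cmod_mult, fact_simpl, mult_INR.
    pose proof (Cmod_ge_0 al); pose proof (Cmod_ge_0 be).
    assert (HnN : (20 * (Cmod al + Cmod be) <= INR (S n))%R).
    { apply Rle_trans with (INR N); [lra|apply le_INR; unfold n1 in Hn; lia]. }
    assert (Hlow : forall z, (20 * Cmod z <= INR (S n))%R ->
      (19 / 20 * INR (S n) <= Cmod (INR (S n) + z))%R).
    { intros z Hz.
      pose proof (Cmod_triangle_sub (INR (S n)) (INR (S n) + z)) as T.
      replace (INR (S n) - (INR (S n) + z)) with (- z) in T by ring.
      rewrite Cmod_opp, Cmod_INR in T; lra. }
    pose proof (Hlow al ltac:(lra)) as La; pose proof (Hlow be ltac:(lra)) as Lb.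
    pose proof (pos_INR (S n)).
    assert (E : (9 / 10 * INR (S n) ^ 2 <= Cmod (INR (S n) + al) * Cmod (INR (S n) + be))%R).
    { apply Rle_trans with (19 / 20 * INR (S n) * (19 / 20 * INR (S n)))%R; [nra|].
      apply Rmult_le_compat; lra. }
    set (c := (Cmod (shifted_prod al be p n1) / d)%R) in *.
    replace (c * (9 / 10) ^ S n * (INR (S n) * INR (fact n)) ^ 2)%R with
      (9 / 10 * INR (S n) ^ 2 * (c * (9 / 10) ^ n * INR (fact n) ^ 2))%R
      by (simpl pow; ring).
    apply Rmult_le_compat; [nra| |exact E|exact IH].
    assert (0 < c)%R by (apply Rdiv_lt_0_compat; lra).
    apply Rmult_le_pos; [apply Rmult_le_pos; [lra|apply pow_le; lra]|].
    apply pow_le, pos_INR.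
Qed.

Lemma numerators_not_subdominant (al be ga : C) (K : R) : H_domain al be ga ->
  ~ (forall n, (Cmod (CF_A (H_a al be) (H_b al be ga) n)
       <= K * (101 / 100) ^ n * INR (fact n) ^ 2)%R).
Proof.
  intros [Ha [Hb [_ Hc]]] HK.
  set (b := (al + be + 1) / 2 - ga) in *.
  assert (Hb2 : forall j, Nat.even j = true -> INR j + 2 * b <> 0)
    by (intros j; now apply even_shift_neq_0).
  assert (Hodd : forall n, degenerate al be n -> Nat.even n = true)
    by (intros n; now apply degenerate_even).
  destruct (degenerate_bounded al be) as [M HM].
  destruct (last_degenerate al be ga Hb2 Hodd M HM) as [p [Hp [Hd [HA Hk]]]].
  set (A := CF_A (H_a al be) (H_b al be ga)) in *.
  set (g := bt_coef al be b p).
  destruct (shifted_prod_lower al be p Hk) as [c [n1 [Hc0 [Hn1 Hlow]]]].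
  destruct (finite_bound (fun n => Cmod (bt n g)) n1) as [B [HB0 HB]].
  assert (HA0 : (0 < Cmod (A p))%R) by now apply Cmod_gt_0.
  (* [B] covers the indices below [n1]; beyond, dividing by the product costs (10/9)^n, and 101/100
     <= 9/10 * 6/5. *)
  apply (bt_not_small al be b g p) with (K := (B + Rabs K / (Cmod (A p) * c))%R).
  - intros j Hj; now apply bt_coef_odd.
  - intros k Hpk; apply (bt_coef_neq_0 al be ga Hb2 p (2 * k)); trivial.
    + intros; apply Hk; lia.
    + lia.
    + apply Nat.even_spec; now exists k.
  - intros k Hpk; unfold g.
    replace (2 * S k)%nat with (S (S (2 * k))) by lia.
    rewrite bt_coef_SS by lia.
    assert (Hnd : ~ degenerate al be (S (S (2 * k)))) by (apply Hk; lia).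
    unfold degenerate in Hnd.
    rewrite !INR_S_C, INR_mul_C, INR_2_C in *.
    field; split; intros E; apply Hnd; rewrite E; ring.
  - intros n.
    assert (H65 : (1 <= (6 / 5) ^ n)%R) by (apply pow_R1_Rle; lra).
    assert (HKc : (0 <= Rabs K / (Cmod (A p) * c))%R).
    { apply Rmult_le_pos; [apply Rabs_pos|left; apply Rinv_0_lt_compat; nra]. }
    destruct (Nat.le_gt_cases n1 n) as [H|H]; [|specialize (HB n H); simpl in HB; nra].
    specialize (HK n); specialize (Hlow n H).
    unfold A in HK; rewrite (numerator_explicit al be ga p n) in HK; trivial; try lia.
    2:{ intros; apply Hk; lia. }
    fold A b g in HK; rewrite !Cmod_mult in HK.
    set (F := (INR (fact n) ^ 2)%R) in *.
    assert (HF : (0 < F)%R) by (apply pow_lt, lt_0_INR, lt_O_fact).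
    pose proof (Cmod_ge_0 (bt n g)) as HG; set (G := Cmod (bt n g)) in *.
    assert (E9 : (0 < (9 / 10) ^ n)%R) by (apply pow_lt; lra).
    assert (E1 : (Cmod (A p) * (c * (9 / 10) ^ n * F) * G <= K * (101 / 100) ^ n * F)%R).
    { eapply Rle_trans; [|exact HK]; apply Rmult_le_compat_r; trivial.
      apply Rmult_le_compat_l; lra. }
    assert (E2 : ((101 / 100) ^ n <= (9 / 10) ^ n * (6 / 5) ^ n)%R).
    { rewrite <- Rpow_mult_distr; apply pow_incr; lra. }
    assert (E3 : (K * (101 / 100) ^ n <= Rabs K * ((9 / 10) ^ n * (6 / 5) ^ n))%R).
    { pose proof (Rle_abs K); pose proof (Rabs_pos K).
      assert (0 < (101 / 100) ^ n)%R by (apply pow_lt; lra).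
      apply Rle_trans with (Rabs K * (101 / 100) ^ n)%R; [nra|nra]. }
    assert (E4 : (Cmod (A p) * c * G <= Rabs K * (6 / 5) ^ n)%R).
    { apply (Rmult_le_reg_l ((9 / 10) ^ n * F)); [nra|].
      replace ((9 / 10) ^ n * F * (Cmod (A p) * c * G))%R with
        (Cmod (A p) * (c * (9 / 10) ^ n * F) * G)%R by ring.
      eapply Rle_trans; [exact E1|].
      replace ((9 / 10) ^ n * F * (Rabs K * (6 / 5) ^ n))%R with
       (Rabs K * ((9 / 10) ^ n * (6 / 5) ^ n) * F)%R by ring.
      apply Rmult_le_compat_r; lra. }
    assert (E5 : (G <= Rabs K / (Cmod (A p) * c) * (6 / 5) ^ n)%R).
    { apply (Rmult_le_reg_l (Cmod (A p) * c)); [nra|].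
      eapply Rle_trans; [exact E4|right; field; split; lra]. }
    nra.
Qed.

(** * Dominant and recessive solutions *)

Section Cone.

Variables (P Q y : nat -> C) (N : nat).
Hypothesis y_rec : forall n, y (S (S n)) = P (S n) * y (S n) - Q (S n) * y n.
Hypothesis P_near : forall n, (N <= n)%nat -> (Cmod (P (S n) - 3) <= / 1000)%R.
Hypothesis Q_near : forall n, (N <= n)%nat -> (Cmod (Q (S n) - 2) <= / 1000)%R.

(** The limit recurrence [y'' = 3 y' - 2 y] has the solutions [2^n] and [1];
    it doubles [y' - y] and preserves [y' - 2 y]. *)
Definition dominant_part (y : nat -> C) (n : nat) : C := y (S n) - y n.
Definition recessive_part (y : nat -> C) (n : nat) : C := y (S n) - 2 * y n.

Lemma perturbation (n : nat) : (N <= n)%nat -> exists e,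
  dominant_part y (S n) = 2 * dominant_part y n + e /\
  recessive_part y (S n) = recessive_part y n + e /\
  (Cmod e <= / 1000 * (3 * Cmod (dominant_part y n) + 2 * Cmod (recessive_part y n)))%R.
Proof.
  intros Hn; exists ((P (S n) - 3) * y (S n) - (Q (S n) - 2) * y n).
  unfold dominant_part, recessive_part; rewrite y_rec; repeat split; try ring.
  set (u := y (S n) - y n); set (w := y (S n) - 2 * y n).
  assert (E1 : y n = u + (- w)) by (unfold u, w; ring).
  assert (E2 : y (S n) = 2 * u + (- w)) by (unfold u, w; ring).
  assert (B1 : (Cmod (y n) <= Cmod u + Cmod w)%R).
  { rewrite E1, <- (Cmod_opp w); apply Cmod_triangle. }
  assert (B2 : (Cmod (y (S n)) <= 2 * Cmod u + Cmod w)%R).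
  { rewrite E2, <- (Cmod_opp w); eapply Rle_trans; [apply Cmod_triangle|].
    rewrite Cmod_mult, Cmod_R, Rabs_pos_eq by lra; lra. }
  eapply Rle_trans; [apply Cmod_triangle|]; rewrite Cmod_opp, !Cmod_mult.
  pose proof (P_near n Hn); pose proof (Q_near n Hn).
  pose proof (Cmod_ge_0 (y n)); pose proof (Cmod_ge_0 (y (S n))).
  pose proof (Cmod_ge_0 (P (S n) - 3)); pose proof (Cmod_ge_0 (Q (S n) - 2)).
  nra.
Qed.

(** Inside the cone the perturbation is at most 5/1000 of the dominant part, which thus grows by
    1.995 at least, while the new recessive part is at most 1.005 times the old dominant part. *)
Lemma cone_step (n : nat) : (N <= n)%nat ->
  (Cmod (recessive_part y n) < Cmod (dominant_part y n))%R ->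
  (Cmod (recessive_part y (S n)) < Cmod (dominant_part y (S n)))%R /\
  (1994 / 1000 * Cmod (dominant_part y n) <= Cmod (dominant_part y (S n)))%R.
Proof.
  intros Hn Hc; destruct (perturbation n Hn) as [e [Eu [Ew He]]].
  set (u := dominant_part y n) in *; set (w := recessive_part y n) in *.
  pose proof (Cmod_ge_0 w).
  assert (B1 : (2 * Cmod u - Cmod e <= Cmod (dominant_part y (S n)))%R).
  { rewrite Eu; pose proof (Cmod_triangle_sub (2 * u) (2 * u + e)) as T.
    replace (2 * u - (2 * u + e)) with (- e) in T by ring.
    rewrite Cmod_opp, Cmod_mult, Cmod_R, Rabs_pos_eq in T by lra; lra. }
  assert (B2 : (Cmod (recessive_part y (S n)) <= Cmod w + Cmod e)%R).
  { rewrite Ew; apply Cmod_triangle. }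
  lra.
Qed.

Lemma cone_forever : (Cmod (recessive_part y N) < Cmod (dominant_part y N))%R ->
  forall n, (N <= n)%nat -> (Cmod (recessive_part y n) < Cmod (dominant_part y n))%R /\
  (Cmod (dominant_part y N) * (1994 / 1000) ^ n <=
     Cmod (dominant_part y n) * (1994 / 1000) ^ N)%R.
Proof.
  intros Hc n Hn; induction Hn as [|n Hn [IH1 IH2]]; [split; lra|].
  destruct (cone_step n Hn IH1) as [S1 S2]; split; trivial.
  assert (0 < (1994 / 1000) ^ N)%R by (apply pow_lt; lra).
  simpl pow; nra.
Qed.

(** [y (S n)] is twice the dominant part minus the recessive part, hence at least the dominant part
    in modulus. *)
Lemma cone_lower : (Cmod (recessive_part y N) < Cmod (dominant_part y N))%R ->
  forall n, (N <= n)%nat ->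
  (Cmod (dominant_part y N) * (1994 / 1000) ^ n <= Cmod (y (S n)) * (1994 / 1000) ^ N)%R.
Proof.
  intros Hc n Hn; destruct (cone_forever Hc n Hn) as [H1 H2].
  eapply Rle_trans; [exact H2|].
  apply Rmult_le_compat_r; [apply pow_le; lra|].
  pose proof (Cmod_triangle_sub (2 * dominant_part y n) (y (S n))) as T.
  replace (2 * dominant_part y n - y (S n)) with (recessive_part y n) in T
    by (unfold dominant_part, recessive_part; ring).
  rewrite Cmod_mult, Cmod_R, Rabs_pos_eq in T by lra; lra.
Qed.

(** Outside the cone the perturbation is at most 5/1000 of the recessive part, which then grows by
    1.005 at most and controls [y]. *)
Lemma never_in_cone :
  (forall n, (N <= n)%nat -> (Cmod (dominant_part y n) <= Cmod (recessive_part y n))%R) ->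
  exists K, forall n, (Cmod (y n) <= K * (101 / 100) ^ n)%R.
Proof.
  intros Hc.
  set (q := (101 / 100)%R).
  assert (Hw : forall n, (N <= n)%nat ->
    (Cmod (recessive_part y n) <= Cmod (recessive_part y N) * q ^ n)%R).
  { intros n Hn; induction Hn as [|n Hn IH].
    - assert (1 <= q ^ N)%R by (apply pow_R1_Rle; unfold q; lra).
      pose proof (Cmod_ge_0 (recessive_part y N)); nra.
    - destruct (perturbation n Hn) as [e [_ [Ew He]]]; specialize (Hc n Hn).
      rewrite Ew; eapply Rle_trans; [apply Cmod_triangle|].
      pose proof (Cmod_ge_0 (recessive_part y n)).
      replace (Cmod (recessive_part y N) * q ^ S n)%R with
        (101 / 100 * (Cmod (recessive_part y N) * q ^ n))%R by (unfold q; simpl; ring).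
      lra. }
  destruct (finite_bound (fun n => Cmod (y n)) N) as [B [HB HBn]].
  exists (B + 2 * Cmod (recessive_part y N))%R; intros n.
  assert (1 <= q ^ n)%R by (apply pow_R1_Rle; unfold q; lra).
  pose proof (Cmod_ge_0 (recessive_part y N)).
  destruct (Nat.le_gt_cases N n) as [Hn|Hn].
  - specialize (Hw n Hn); specialize (Hc n Hn).
    assert (E : y n = dominant_part y n + - recessive_part y n)
      by (unfold dominant_part, recessive_part; ring).
    assert (Cmod (y n) <= Cmod (dominant_part y n) + Cmod (recessive_part y n))%R.
    { rewrite E at 1; rewrite <- (Cmod_opp (recessive_part y n)); apply Cmod_triangle. }
    nra.
  - specialize (HBn n Hn); simpl in HBn; nra.
Qed.

End Cone.

(** The rate is chosen so that [(357/100)^2 - 3001/1000 * 357/100 - 2001/1000]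
    exceeds [3/100], while [201/100 * (357/100) / (1994/1000)^3 < 91/100]. *)
Lemma second_order_upper (d : nat -> R) (c s : R) (N : nat) :
  (forall n, 0 <= d n)%R -> (0 <= c)%R -> (s <= 3 / 100 * c)%R ->
  (forall n, (N <= n)%nat ->
    (d (S (S n)) <= 3001 / 1000 * d (S n) + 2001 / 1000 * d n + s * (357 / 100) ^ n)%R) ->
  (d N <= c)%R -> (d (S N) <= c)%R ->
  forall n, (N <= n)%nat -> (d n <= c * (357 / 100) ^ n)%R.
Proof.
  intros Hd Hc Hs Hrec H0 H1.
  assert (HP : forall n, (1 <= (357 / 100) ^ n)%R) by (intros; apply pow_R1_Rle; lra).
  assert (H : forall n, (N <= n)%nat ->
    (d n <= c * (357 / 100) ^ n)%R /\ (d (S n) <= c * (357 / 100) ^ S n)%R).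
  { intros n Hn; induction Hn as [|n Hn [IH1 IH2]].
    - pose proof (HP N); pose proof (HP (S N)); split; nra.
    - split; trivial; specialize (Hrec n Hn); specialize (HP n).
      simpl pow in *.
      assert (s * (357 / 100) ^ n <= 3 / 100 * c * (357 / 100) ^ n)%R
        by (apply Rmult_le_compat_r; lra).
      assert (0 <= c * (357 / 100) ^ n)%R by (apply Rmult_le_pos; lra).
      lra. }
  intros n Hn; now apply H.
Qed.

(** The constant 9/1000 is the margin 201/100 - 2001/1000, which absorbs the source term. *)
Lemma first_order_upper (d : nat -> R) (c s : R) (N : nat) :
  (0 <= c)%R -> (s <= 9 / 1000 * c)%R ->
  (forall n, (N <= n)%nat ->
    (d (S n) <= 2001 / 1000 * d n + s * (201 / 100) ^ n)%R) ->
  (d N <= c)%R ->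
  forall n, (N <= n)%nat -> (d n <= c * (201 / 100) ^ n)%R.
Proof.
  intros Hc Hs Hrec H0 n Hn.
  assert (HP : forall n, (1 <= (201 / 100) ^ n)%R) by (intros; apply pow_R1_Rle; lra).
  induction Hn as [|n Hn IH]; [pose proof (HP N); nra|].
  specialize (Hrec n Hn); specialize (HP n); simpl pow.
  assert (s * (201 / 100) ^ n <= 9 / 1000 * c * (201 / 100) ^ n)%R
    by (apply Rmult_le_compat_r; lra).
  lra.
Qed.

(** * Solutions depending on a parameter *)

(** Boundedness is included to obtain closure under products. *)
Definition bounded_lipschitz (D : C -> Prop) (f : C -> C) : Prop :=
  exists K, (0 <= K)%R /\ forall z z', D z -> D z' ->
    (Cmod (f z) <= K)%R /\ (Cmod (f z - f z') <= K * Cmod (z - z'))%R.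

Lemma bounded_lipschitz_plus (D : C -> Prop) (f g : C -> C) :
  bounded_lipschitz D f -> bounded_lipschitz D g ->
  bounded_lipschitz D (fun z => f z + g z).
Proof.
  intros [K [HK Hf]] [L [HL Hg]]; exists (K + L)%R; split; [lra|]; intros z z' Hz Hz'.
  destruct (Hf z z' Hz Hz') as [F1 F2]; destruct (Hg z z' Hz Hz') as [G1 G2]; split.
  - eapply Rle_trans; [apply Cmod_triangle|lra].
  - replace (f z + g z - (f z' + g z')) with ((f z - f z') + (g z - g z')) by ring.
    eapply Rle_trans; [apply Cmod_triangle|lra].
Qed.

Lemma bounded_lipschitz_mult (D : C -> Prop) (f g : C -> C) :
  bounded_lipschitz D f -> bounded_lipschitz D g ->
  bounded_lipschitz D (fun z => f z * g z).
Proof.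
  intros [K [HK Hf]] [L [HL Hg]]; exists (2 * (K * L))%R; split; [nra|]; intros z z' Hz Hz'.
  destruct (Hf z z' Hz Hz') as [F1 F2]; destruct (Hg z z' Hz Hz') as [G1 G2].
  destruct (Hf z' z Hz' Hz) as [F3 _].
  pose proof (Cmod_ge_0 (f z)); pose proof (Cmod_ge_0 (g z)); pose proof (Cmod_ge_0 (f z')).
  pose proof (Cmod_ge_0 (f z - f z')); pose proof (Cmod_ge_0 (g z - g z')).
  split.
  - rewrite Cmod_mult; nra.
  - replace (f z * g z - f z' * g z') with ((f z - f z') * g z + f z' * (g z - g z')) by ring.
    eapply Rle_trans; [apply Cmod_triangle|]; rewrite !Cmod_mult.
    assert (Cmod (f z - f z') * Cmod (g z) <= K * Cmod (z - z') * L)%R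
      by (apply Rmult_le_compat; lra).
    assert (Cmod (f z') * Cmod (g z - g z') <= K * (L * Cmod (z - z')))%R
      by (apply Rmult_le_compat; lra).
    lra.
Qed.

Lemma bounded_lipschitz_const (D : C -> Prop) (c : C) :
  bounded_lipschitz D (fun _ => c).
Proof.
  exists (Cmod c); split; [apply Cmod_ge_0|]; intros z z' _ _; split; [lra|].
  replace (c - c) with (RtoC 0) by ring; rewrite Cmod_0.
  apply Rmult_le_pos; apply Cmod_ge_0.
Qed.

Lemma bounded_lipschitz_minus (D : C -> Prop) (f g : C -> C) :
  bounded_lipschitz D f -> bounded_lipschitz D g ->
  bounded_lipschitz D (fun z => f z - g z).
Proof.
  intros Hf Hg.
  destruct (bounded_lipschitz_plus D f (fun z => -(1) * g z)) as [K [HK H]]; trivial.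
  { apply bounded_lipschitz_mult; trivial; apply bounded_lipschitz_const. }
  exists K; split; trivial; intros z z' Hz Hz'; specialize (H z z' Hz Hz').
  replace (f z - g z) with (f z + - (1) * g z) by ring.
  now replace (f z' - g z') with (f z' + - (1) * g z') by ring.
Qed.

Section Family.

Variables (D : C -> Prop) (P Q y t : nat -> C -> C) (N : nat) (K c0 : R).
Hypothesis y_rec : forall z n, y (S (S n)) z = P (S n) z * y (S n) z - Q (S n) z * y n z.
Hypothesis t_rec : forall z n, t (S (S n)) z = P (S n) z * t (S n) z - Q (S n) z * t n z.
Hypothesis P_near : forall z n, D z -> (N <= n)%nat -> (Cmod (P (S n) z - 3) <= / 1000)%R.
Hypothesis Q_near : forall z n, D z -> (N <= n)%nat -> (Cmod (Q (S n) z - 2) <= / 1000)%R.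
Hypothesis HK : (0 <= K)%R.
Hypothesis P_lip : forall z z' n, D z -> D z' -> (N <= n)%nat ->
  (Cmod (P (S n) z - P (S n) z') <= K * Cmod (z - z'))%R.
Hypothesis Q_lip : forall z z' n, D z -> D z' -> (N <= n)%nat ->
  (Cmod (Q (S n) z - Q (S n) z') <= K * Cmod (z - z'))%R.
Hypothesis y_bl : forall n, bounded_lipschitz D (y n).
Hypothesis t_bl : forall n, bounded_lipschitz D (t n).
Hypothesis Hc0 : (0 < c0)%R.
Hypothesis y_cone : forall z, D z ->
  (Cmod (recessive_part (fun n => y n z) N) < Cmod (dominant_part (fun n => y n z) N))%R /\
  (c0 <= Cmod (dominant_part (fun n => y n z) N))%R.

Let wronskian (n : nat) (z : C) : C := t (S n) z * y n z - t n z * y (S n) z.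

Lemma P_bound (z : C) (n : nat) : D z -> (N <= n)%nat -> (Cmod (P (S n) z) <= 3001 / 1000)%R.
Proof.
  intros Hz Hn; specialize (P_near z n Hz Hn).
  pose proof (Cmod_triangle_sub (P (S n) z) 3) as T.
  rewrite (Cmod_R 3), Rabs_pos_eq in T by lra; lra.
Qed.

Lemma Q_bound (z : C) (n : nat) : D z -> (N <= n)%nat -> (Cmod (Q (S n) z) <= 2001 / 1000)%R.
Proof.
  intros Hz Hn; specialize (Q_near z n Hz Hn).
  pose proof (Cmod_triangle_sub (Q (S n) z) 2) as T.
  rewrite (Cmod_R 2), Rabs_pos_eq in T by lra; lra.
Qed.

(** The triangle inequality loses the sign in 3 y' - 2 y, so the rate is not 2 but slightly above
    the root (3 + sqrt 17)/2 of X^2 = 3 X + 2. *)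
Lemma family_upper : exists c, (0 <= c)%R /\ forall z n, D z -> (N <= n)%nat ->
  (Cmod (y n z) <= c * (357 / 100) ^ n)%R.
Proof.
  destruct (y_bl N) as [K1 [HK1 H1]]; destruct (y_bl (S N)) as [K2 [HK2 H2]].
  exists (K1 + K2)%R; split; [lra|]; intros z n Hz Hn.
  apply (second_order_upper (fun n => Cmod (y n z)) _ 0 N); trivial; try lra.
  - intros; apply Cmod_ge_0.
  - intros m Hm; rewrite y_rec; eapply Rle_trans; [apply Cmod_triangle|].
    rewrite Cmod_opp, !Cmod_mult.
    pose proof (P_bound z m Hz Hm); pose proof (Q_bound z m Hz Hm).
    pose proof (Cmod_ge_0 (y m z)); pose proof (Cmod_ge_0 (y (S m) z)); nra.
  - destruct (H1 z z Hz Hz); lra.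
  - destruct (H2 z z Hz Hz); lra.
Qed.

(** The difference at two parameters obeys the same inequality, with a source coming from the
    variation of [P] and [Q]. Here 457/100 = 357/100 + 1 collects the two sources, and 100/3 inverts
    the margin in [second_order_upper]. *)
Lemma family_lipschitz : exists c, (0 <= c)%R /\ forall z z' n, D z -> D z' -> (N <= n)%nat ->
  (Cmod (y n z - y n z') <= c * Cmod (z - z') * (357 / 100) ^ n)%R.
Proof.
  destruct family_upper as [cy [Hcy Hy]].
  destruct (y_bl N) as [K1 [HK1 H1]]; destruct (y_bl (S N)) as [K2 [HK2 H2]].
  set (s := (K * cy * (457 / 100))%R).
  assert (Hs : (0 <= s)%R) by (unfold s; nra).
  exists (K1 + K2 + s * (100 / 3))%R; split; [lra|].
  intros z z' n Hz Hz' Hn.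
  set (del := Cmod (z - z')).
  assert (Hdel : (0 <= del)%R) by apply Cmod_ge_0.
  apply (second_order_upper (fun n => Cmod (y n z - y n z')) _ (s * del) N); trivial; try nra.
  - intros; apply Cmod_ge_0.
  - intros m Hm; rewrite !y_rec.
    replace (P (S m) z * y (S m) z - Q (S m) z * y m z -
      (P (S m) z' * y (S m) z' - Q (S m) z' * y m z')) with
      ((P (S m) z * (y (S m) z - y (S m) z') + - (Q (S m) z * (y m z - y m z'))) +
       ((P (S m) z - P (S m) z') * y (S m) z' + - ((Q (S m) z - Q (S m) z') * y m z')))
      by ring.
    eapply Rle_trans; [apply Cmod_triangle|].
    eapply Rle_trans; [apply Rplus_le_compat; apply Cmod_triangle|].
    rewrite !Cmod_opp, !Cmod_mult.
    pose proof (P_bound z m Hz Hm); pose proof (Q_bound z m Hz Hm).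
    pose proof (Cmod_ge_0 (y m z - y m z')); pose proof (Cmod_ge_0 (y (S m) z - y (S m) z')).
    assert (A1 : (Cmod (P (S m) z - P (S m) z') * Cmod (y (S m) z') <=
       K * del * (cy * (357 / 100) ^ S m))%R).
    { apply Rmult_le_compat; try apply Cmod_ge_0; [now apply P_lip|apply Hy; trivial; lia]. }
    assert (A2 : (Cmod (Q (S m) z - Q (S m) z') * Cmod (y m z') <=
       K * del * (cy * (357 / 100) ^ m))%R).
    { apply Rmult_le_compat; try apply Cmod_ge_0; [now apply Q_lip|apply Hy; trivial; lia]. }
    replace (s * del * (357 / 100) ^ m)%R with
     (K * del * (cy * (357 / 100) ^ S m) + K * del * (cy * (357 / 100) ^ m))%R
     by (unfold s; simpl pow; field).
    nra.
  - destruct (H1 z z' Hz Hz') as [_ H]; fold del in H; nra.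
  - destruct (H2 z z' Hz Hz') as [_ H]; fold del in H; nra.
Qed.

Lemma wronskian_rec (n : nat) (z : C) : wronskian (S n) z = Q (S n) z * wronskian n z.
Proof. unfold wronskian; rewrite y_rec, t_rec; ring. Qed.

Lemma wronskian_bl : bounded_lipschitz D (wronskian N).
Proof.
  apply bounded_lipschitz_minus; apply bounded_lipschitz_mult; trivial.
Qed.

Lemma wronskian_upper : exists c, (0 <= c)%R /\ forall z n, D z -> (N <= n)%nat ->
  (Cmod (wronskian n z) <= c * (201 / 100) ^ n)%R.
Proof.
  destruct wronskian_bl as [K1 [HK1 H1]].
  exists K1; split; trivial; intros z n Hz Hn.
  apply (first_order_upper (fun n => Cmod (wronskian n z)) _ 0 N); trivial; try lra.
  - intros m Hm; rewrite wronskian_rec, Cmod_mult.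
    pose proof (Q_bound z m Hz Hm); pose proof (Cmod_ge_0 (wronskian m z)); nra.
  - now destruct (H1 z z Hz Hz).
Qed.

Lemma wronskian_lipschitz : exists c, (0 <= c)%R /\
  forall z z' n, D z -> D z' -> (N <= n)%nat ->
  (Cmod (wronskian n z - wronskian n z') <= c * Cmod (z - z') * (201 / 100) ^ n)%R.
Proof.
  destruct wronskian_upper as [cw [Hcw Hw]].
  destruct wronskian_bl as [K1 [HK1 H1]].
  assert (HKw : (0 <= K * cw)%R) by nra.
  exists (K1 + K * cw * (1000 / 9))%R; split; [lra|].
  intros z z' n Hz Hz' Hn.
  set (del := Cmod (z - z')).
  assert (Hdel : (0 <= del)%R) by apply Cmod_ge_0.
  apply (first_order_upper (fun n => Cmod (wronskian n z - wronskian n z')) _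
    (K * cw * del) N); trivial; try nra.
  - intros m Hm; rewrite !wronskian_rec.
    replace (Q (S m) z * wronskian m z - Q (S m) z' * wronskian m z') with
      (Q (S m) z * (wronskian m z - wronskian m z') + (Q (S m) z - Q (S m) z') * wronskian m z')
      by ring.
    eapply Rle_trans; [apply Cmod_triangle|]; rewrite !Cmod_mult.
    pose proof (Q_bound z m Hz Hm); pose proof (Cmod_ge_0 (wronskian m z - wronskian m z')).
    assert (A2 : (Cmod (Q (S m) z - Q (S m) z') * Cmod (wronskian m z') <=
       K * del * (cw * (201 / 100) ^ m))%R).
    { apply Rmult_le_compat; try apply Cmod_ge_0; [now apply Q_lip|apply Hw; trivial; lia]. }
    nra.
  - destruct (H1 z z' Hz Hz') as [_ H]; fold del in H; nra.
Qed.

Lemma family_inv_upper : exists k, (0 <= k)%R /\ forall z n, D z -> (S N <= n)%nat ->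
  y n z <> 0 /\ (Cmod (/ y n z) <= k * (502 / 1000) ^ n)%R.
Proof.
  set (M := ((1994 / 1000) ^ N)%R).
  assert (HM : (0 < M)%R) by (apply pow_lt; lra).
  (* The base 502/1000 exceeds 1/1.994. The factor 2 pays for the shift from [n] to [S n] in
     [cone_lower], since 2 * 502/1000 >= 1. *)
  exists (M / c0 * 2)%R; split.
  { apply Rmult_le_pos; [|lra]; left; now apply Rdiv_lt_0_compat. }
  intros z [|n] Hz Hn; [lia|].
  destruct (y_cone z Hz) as [Hc Hc'].
  pose proof (cone_lower (fun n => P n z) (fun n => Q n z) (fun n => y n z) N (y_rec z)
    (fun n => P_near z n Hz) (fun n => Q_near z n Hz) Hc n ltac:(lia)) as L.
  fold M in L.
  assert (Hmu : (0 < (1994 / 1000) ^ n)%R) by (apply pow_lt; lra).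
  assert (L2 : (c0 * (1994 / 1000) ^ n <= Cmod (y (S n) z) * M)%R).
  { eapply Rle_trans; [|exact L]; apply Rmult_le_compat_r; lra. }
  assert (Hpos : (0 < Cmod (y (S n) z))%R).
  { apply (Rmult_lt_reg_r M); trivial; rewrite Rmult_0_l.
    apply Rlt_le_trans with (2 := L2); now apply Rmult_lt_0_compat. }
  assert (Hne : y (S n) z <> 0) by now apply Cmod_gt_0.
  split; trivial; rewrite Cmod_inv by assumption.
  assert (Hnu : (1 <= (1994 / 1000) ^ n * (502 / 1000) ^ n)%R).
  { rewrite <- Rpow_mult_distr; apply pow_R1_Rle; lra. }
  assert (Hnu0 : (0 < (502 / 1000) ^ n)%R) by (apply pow_lt; lra).
  apply (Rmult_le_reg_l (Cmod (y (S n) z))); trivial.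
  rewrite Rinv_r by lra; simpl pow.
  replace (Cmod (y (S n) z) * (M / c0 * 2 * (502 / 1000 * (502 / 1000) ^ n)))%R with
    (Cmod (y (S n) z) * M * (/ c0 * (1004 / 1000) * (502 / 1000) ^ n))%R by (field; lra).
  apply Rle_trans with (c0 * (1994 / 1000) ^ n * (/ c0 * (1004 / 1000) * (502 / 1000) ^ n))%R.
  - replace (c0 * (1994 / 1000) ^ n * (/ c0 * (1004 / 1000) * (502 / 1000) ^ n))%R with
     (1004 / 1000 * ((1994 / 1000) ^ n * (502 / 1000) ^ n))%R by (field; lra).
    lra.
  - apply Rmult_le_compat_r; trivial.
    repeat apply Rmult_le_pos; try lra; left; now apply Rinv_0_lt_compat.
Qed.

Lemma ratio_increment (n : nat) (z : C) : y n z <> 0 -> y (S n) z <> 0 ->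
  t (S n) z / y (S n) z - t n z / y n z = wronskian n z * (/ y n z * / y (S n) z).
Proof. intros; unfold wronskian; field; split; assumption. Qed.

(** Variation of the Wronskian meets two inverses of [y], and 2.01 * 0.502^2 is well below 0.91.
    Variation of [y] has the crude rate 3.57, but it is accompanied by a third inverse: 2.01 * 3.57
    * 0.502^3 < 0.91. *)
Lemma ratio_increment_bounds : exists L, (0 <= L)%R /\ forall n, (S N <= n)%nat ->
  (forall z, D z ->
    (Cmod (t (S n) z / y (S n) z - t n z / y n z) <= L * (91 / 100) ^ n)%R) /\
  (forall z z', D z -> D z' ->
    (Cmod ((t (S n) z / y (S n) z - t n z / y n z) - (t (S n) z' / y (S n) z' - t n z' / y n z'))
     <= L * (91 / 100) ^ n * Cmod (z - z'))%R).
Proof.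
  destruct family_lipschitz as [cy [Hcy Hy]].
  destruct wronskian_upper as [cw [Hcw Hw]].
  destruct wronskian_lipschitz as [cl [Hcl Hl]].
  destruct family_inv_upper as [k [Hk Hi]].
  set (v := (fun n : nat => k * (502 / 1000) ^ n)%R).
  assert (Hv : forall n, (0 <= v n)%R) by (intros; apply Rmult_le_pos; [lra|apply pow_le; lra]).
  assert (HvS : forall n, (v (S n) <= v n)%R).
  { intros n; specialize (Hv n); unfold v in *; simpl pow; nra. }
  set (L1 := ((cw + cl) * (k * k))%R); set (L2 := (cw * cy * (k * k * k) * (457 / 100))%R).
  assert (HL1 : (0 <= L1)%R) by (repeat apply Rmult_le_pos; lra).
  assert (HL2 : (0 <= L2)%R) by (repeat apply Rmult_le_pos; lra).
  assert (HB1 : forall n c, (0 <= c)%R ->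
    (c * (201 / 100) ^ n * (v n * v n) <= c * (k * k) * (91 / 100) ^ n)%R).
  { intros n c Hc; unfold v.
    replace (c * (201 / 100) ^ n * (k * (502 / 1000) ^ n * (k * (502 / 1000) ^ n)))%R with
      (c * (k * k) * ((201 / 100) ^ n * (502 / 1000) ^ n * (502 / 1000) ^ n))%R by ring.
    apply Rmult_le_compat_l; [apply Rmult_le_pos; nra|].
    rewrite <- !Rpow_mult_distr; apply pow_incr; lra. }
  assert (HB2 : forall n c, (0 <= c)%R ->
    (c * ((201 / 100) ^ n * (357 / 100) ^ n) * (v n * v n * v n) <=
     c * (k * k * k) * (91 / 100) ^ n)%R).
  { intros n c Hc; unfold v.
    replace (c * ((201 / 100) ^ n * (357 / 100) ^ n) *
      (k * (502 / 1000) ^ n * (k * (502 / 1000) ^ n) * (k * (502 / 1000) ^ n)))%R with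
      (c * (k * k * k) * ((201 / 100) ^ n * (357 / 100) ^ n * (502 / 1000) ^ n *
        (502 / 1000) ^ n * (502 / 1000) ^ n))%R by ring.
    apply Rmult_le_compat_l; [repeat apply Rmult_le_pos; lra|].
    rewrite <- !Rpow_mult_distr; apply pow_incr; lra. }
  exists (L1 + L2)%R; split; [lra|]; intros n Hn.
  assert (Hth : (0 < (91 / 100) ^ n)%R) by (apply pow_lt; lra).
  assert (Hn' : (N <= n)%nat) by lia.
  split.
  - intros z Hz.
    destruct (Hi z n Hz Hn) as [N1 I1]; destruct (Hi z (S n) Hz ltac:(lia)) as [N2 I2].
    fold (v n) in I1; fold (v (S n)) in I2.
    rewrite ratio_increment, !Cmod_mult by assumption.
    apply Rle_trans with (cw * (201 / 100) ^ n * (v n * v n))%R.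
    + apply Rmult_le_compat; try apply Cmod_ge_0; try (apply Rmult_le_pos; apply Cmod_ge_0).
      * now apply Hw.
      * apply Rmult_le_compat; try apply Cmod_ge_0; trivial.
        eapply Rle_trans; [exact I2|apply HvS].
    + eapply Rle_trans; [now apply HB1|].
      apply Rmult_le_compat_r; [lra|]; unfold L1 in *; nra.
  - intros z z' Hz Hz'.
    destruct (Hi z n Hz Hn) as [N1 I1]; destruct (Hi z (S n) Hz ltac:(lia)) as [N2 I2].
    destruct (Hi z' n Hz' Hn) as [N3 I3]; destruct (Hi z' (S n) Hz' ltac:(lia)) as [N4 I4].
    fold (v n) in I1, I3; fold (v (S n)) in I2, I4.
    apply (fun H => Rle_trans _ _ _ H (HvS n)) in I2.
    apply (fun H => Rle_trans _ _ _ H (HvS n)) in I4.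
    rewrite !ratio_increment by assumption.
    set (del := Cmod (z - z')).
    assert (Hdel : (0 <= del)%R) by apply Cmod_ge_0.
    (* One factor is varied at a time; 1/y - 1/y' = (y' - y)/(y y') supplies the third inverse. *)
    replace (wronskian n z * (/ y n z * / y (S n) z) - wronskian n z' * (/ y n z' * / y (S n) z'))
    with ((wronskian n z - wronskian n z') * (/ y n z * / y (S n) z) +
      (wronskian n z' * (y (S n) z' - y (S n) z) * (/ y n z * / y (S n) z * / y (S n) z') +
       wronskian n z' * (y n z' - y n z) * (/ y n z * / y n z' * / y (S n) z')))
      by (field; repeat split; assumption).
    eapply Rle_trans; [apply Cmod_triangle|].
    eapply Rle_trans; [apply Rplus_le_compat_l, Cmod_triangle|].
    rewrite !Cmod_mult.
    pose proof (Cmod_ge_0 (/ y n z)); pose proof (Cmod_ge_0 (/ y (S n) z)).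
    pose proof (Cmod_ge_0 (/ y n z')); pose proof (Cmod_ge_0 (/ y (S n) z')).
    assert (Z2 : forall a b : R, (0 <= a <= v n)%R -> (0 <= b <= v n)%R ->
      (0 <= a * b <= v n * v n)%R).
    { intros a b Ha Hb; split; [nra|apply Rmult_le_compat; lra]. }
    assert (Z3 : forall a b c : R, (0 <= a <= v n)%R -> (0 <= b <= v n)%R ->
      (0 <= c <= v n)%R -> (0 <= a * b * c <= v n * v n * v n)%R).
    { intros a b c Ha Hb Hc; destruct (Z2 a b Ha Hb); split; [nra|].
      apply Rmult_le_compat; lra. }
    assert (T1 : (Cmod (wronskian n z - wronskian n z') * (Cmod (/ y n z) * Cmod (/ y (S n) z)) <=
      cl * (k * k) * (91 / 100) ^ n * del)%R).
    { apply Rle_trans with (cl * del * (201 / 100) ^ n * (v n * v n))%R.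
      - apply Rmult_le_compat; [apply Cmod_ge_0|apply Z2; lra|now apply Hl|apply Z2; lra].
      - eapply Rle_trans; [apply HB1; now apply Rmult_le_pos|right; ring]. }
    assert (T2 : (Cmod (wronskian n z') * Cmod (y (S n) z' - y (S n) z) *
      (Cmod (/ y n z) * Cmod (/ y (S n) z) * Cmod (/ y (S n) z')) <=
      cw * cy * (357 / 100) * (k * k * k) * (91 / 100) ^ n * del)%R).
    { apply Rle_trans with (cw * cy * (357 / 100) * del * ((201 / 100) ^ n * (357 / 100) ^ n)
         * (v n * v n * v n))%R.
      - apply Rmult_le_compat; [apply Rmult_le_pos; apply Cmod_ge_0|apply Z3; lra| |apply Z3; lra].
        replace (cw * cy * (357 / 100) * del * ((201 / 100) ^ n * (357 / 100) ^ n))%R with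
         (cw * (201 / 100) ^ n * (cy * del * (357 / 100) ^ S n))%R by (simpl pow; ring).
        rewrite (Cmod_sub_sym (y (S n) z')).
        apply Rmult_le_compat; try apply Cmod_ge_0; [now apply Hw|apply Hy; trivial; lia].
      - eapply Rle_trans; [apply HB2; repeat apply Rmult_le_pos; lra|right; ring]. }
    assert (T3 : (Cmod (wronskian n z') * Cmod (y n z' - y n z) *
      (Cmod (/ y n z) * Cmod (/ y n z') * Cmod (/ y (S n) z')) <=
      cw * cy * (k * k * k) * (91 / 100) ^ n * del)%R).
    { apply Rle_trans with (cw * cy * del * ((201 / 100) ^ n * (357 / 100) ^ n)
         * (v n * v n * v n))%R.
      - apply Rmult_le_compat; [apply Rmult_le_pos; apply Cmod_ge_0|apply Z3; lra| |apply Z3; lra].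
        replace (cw * cy * del * ((201 / 100) ^ n * (357 / 100) ^ n))%R with
         (cw * (201 / 100) ^ n * (cy * del * (357 / 100) ^ n))%R by ring.
        rewrite (Cmod_sub_sym (y n z')).
        apply Rmult_le_compat; try apply Cmod_ge_0; [now apply Hw|apply Hy; trivial; lia].
      - eapply Rle_trans; [apply HB2; repeat apply Rmult_le_pos; lra|right; ring]. }
    assert (T4 : (0 <= cw * (k * k) * (91 / 100) ^ n * del)%R)
      by (repeat apply Rmult_le_pos; lra).
    unfold L1, L2; lra.
Qed.

End Family.

(** * Limits with geometrically small increments *)

Definition C_derivable_to (f : C -> C) (z l : C) : Prop :=
  @is_derive C_AbsRing C_NormedModule f z l.

(** Both module structures on [C] have the norm [Cmod], so only the linearity half of the derivative
    has to be proved again. The product and chain rules below need the first structure. *)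
Lemma C_derivable_to_AbsRing (f : C -> C) (z l : C) :
  @is_derive C_AbsRing (AbsRing_NormedModule C_AbsRing) f z l <-> C_derivable_to f z l.
Proof.
  split; intros [_ H]; (split; [apply is_linear_scal_l|exact H]).
Qed.

Lemma C_derivable_toE (f : C -> C) (z l : C) :
  C_derivable_to f z l <-> forall eps : R, (0 < eps)%R -> exists del, (0 < del)%R /\
    forall w, (Cmod (w - z) < del)%R ->
      (Cmod (f w - f z - (w - z) * l) <= eps * Cmod (w - z))%R.
Proof.
  split.
  - intros [_ H] eps Heps.
    destruct (H z (fun P HP => HP) (mkposreal eps Heps)) as [del Hd].
    exists del; split; [apply cond_pos|]; intros w Hw; exact (Hd w Hw).
  - intros H; split; [apply is_linear_scal_l|].
    intros x Hx.
    replace x with z by (apply (@is_filter_lim_locally_unique C_AbsRing (AbsRing_NormedModule C_AbsRing)); exact Hx).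
    intros eps; destruct (H eps (cond_pos eps)) as [del [Hdel Hd]].
    exists (mkposreal del Hdel); intros w Hw; exact (Hd w Hw).
Qed.

Lemma C_derivable_to_inv (z : C) : z <> 0 -> C_derivable_to Cinv z (- / (z * z)).
Proof.
  intros Hz; apply C_derivable_toE; intros eps Heps.
  assert (Hm : (0 < Cmod z)%R) by now apply Cmod_gt_0.
  set (m := Cmod z) in *.
  (* The first bound keeps |w| above m/2; the second then makes |w - z| / (m^2 |w|) at most eps. *)
  exists (Rmin (m / 2) (eps * m ^ 3 / 2)); split.
  { apply Rmin_glb_lt; [lra|]; apply Rdiv_lt_0_compat; [|lra].
    apply Rmult_lt_0_compat; [lra|now apply pow_lt]. }
  intros w Hw.
  pose proof (Rlt_le_trans _ _ _ Hw (Rmin_l _ _)) as W1.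
  pose proof (Rlt_le_trans _ _ _ Hw (Rmin_r _ _)) as W2.
  pose proof (Cmod_triangle_sub z w) as T; rewrite (Cmod_sub_sym z w) in T; fold m in T.
  assert (Hwm : (m / 2 < Cmod w)%R) by lra.
  assert (Hw0 : w <> 0) by (apply Cmod_gt_0; lra).
  replace (/ w - / z - (w - z) * - / (z * z)) with ((w - z) * (w - z) * / (z * z * w))
    by (field; split; assumption).
  rewrite !Cmod_mult, Cmod_inv, !Cmod_mult by (repeat apply Cmult_neq_0; assumption).
  fold m; set (d := Cmod (w - z)) in *.
  assert (Hd : (0 <= d)%R) by apply Cmod_ge_0.
  rewrite Rmult_assoc, Rmult_comm; apply Rmult_le_compat_r; trivial.
  apply (Rmult_le_reg_r (m * m * Cmod w)); [repeat apply Rmult_lt_0_compat; lra|].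
  rewrite Rmult_assoc, Rinv_l, Rmult_1_r by (apply Rgt_not_eq; repeat apply Rmult_lt_0_compat; lra).
  apply Rle_trans with (eps * (m * m * (m / 2)))%R.
  - simpl in W2; lra.
  - apply Rmult_le_compat_l; [lra|]; apply Rmult_le_compat_l; nra.
Qed.

Definition C_derivable (f : C -> C) (z : C) : Prop := exists l, C_derivable_to f z l.

Lemma C_derivable_const (c z : C) : C_derivable (fun _ => c) z.
Proof. exists 0; apply (@is_derive_const C_AbsRing C_NormedModule). Qed.

Lemma C_derivable_id (z : C) : C_derivable (fun w => w) z.
Proof.
  exists 1; apply C_derivable_toE; intros eps Heps; exists 1%R; split; [lra|].
  intros w _; replace (w - z - (w - z) * 1) with (RtoC 0) by ring.
  rewrite Cmod_0; apply Rmult_le_pos; [lra|apply Cmod_ge_0].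
Qed.

Lemma C_derivable_plus (f g : C -> C) (z : C) :
  C_derivable f z -> C_derivable g z -> C_derivable (fun w => f w + g w) z.
Proof.
  intros [l Hl] [m Hm]; exists (l + m).
  now apply (@is_derive_plus C_AbsRing C_NormedModule).
Qed.

Lemma C_derivable_mult (f g : C -> C) (z : C) :
  C_derivable f z -> C_derivable g z -> C_derivable (fun w => f w * g w) z.
Proof.
  intros [l Hl] [m Hm]; exists (l * g z + f z * m).
  apply C_derivable_to_AbsRing in Hl; apply C_derivable_to_AbsRing in Hm.
  apply C_derivable_to_AbsRing.
  exact (@is_derive_mult C_AbsRing f g z l m Hl Hm Cmult_comm).
Qed.

Lemma C_derivable_inv (f : C -> C) (z : C) :
  f z <> 0 -> C_derivable f z -> C_derivable (fun w => / f w) z.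
Proof.
  intros Hz [l Hl]; eexists.
  apply (@is_derive_comp C_AbsRing C_NormedModule Cinv f z).
  - now apply C_derivable_to_inv.
  - apply C_derivable_to_AbsRing. exact Hl.
Qed.

(** Passes the small Lipschitz constants of the increments on to their derivatives. *)
Lemma derivative_le_lipschitz (f : C -> C) (z l : C) (r L : R) : (0 < r)%R ->
  (forall w, (Cmod (w - z) < r)%R -> (Cmod (f w - f z) <= L * Cmod (w - z))%R) ->
  C_derivable_to f z l -> (Cmod l <= L)%R.
Proof.
  intros Hr HL Hl; apply Rle_plus_epsilon; intros eps Heps.
  rewrite C_derivable_toE in Hl; destruct (Hl eps Heps) as [del [Hdel Hd]].
  set (s := (Rmin r del / 2)%R).
  assert (Hs : (0 < s)%R).
  { assert (0 < Rmin r del)%R by (now apply Rmin_glb_lt); unfold s; lra. }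
  pose proof (Rmin_l r del); pose proof (Rmin_r r del).
  assert (E : z + s - z = s) by ring.
  assert (Es : Cmod (z + s - z) = s) by (rewrite E, Cmod_R; apply Rabs_pos_eq; lra).
  specialize (HL (z + s)); specialize (Hd (z + s)); rewrite Es in HL, Hd.
  specialize (HL ltac:(unfold s in *; lra)); specialize (Hd ltac:(unfold s in *; lra)).
  rewrite E in Hd.
  pose proof (Cmod_triangle_sub (s * l) (f (z + s) - f z)) as T.
  rewrite (Cmod_sub_sym (s * l)) in T.
  rewrite Cmod_mult, Cmod_R, Rabs_pos_eq in T by lra.
  apply (Rmult_le_reg_l s); trivial; lra.
Qed.

Section GeometricLimit.

Variable th : R.
Hypothesis Hth : (0 <= th < 1)%R.

Lemma geometric_tail (x : nat -> C) (K : R) (N : nat) : (0 <= K)%R ->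
  (forall n, (N <= n)%nat -> (Cmod (x (S n) - x n) <= K * th ^ n)%R) ->
  forall n d, (N <= n)%nat -> (Cmod (x (n + d)%nat - x n) <= K / (1 - th) * th ^ n)%R.
Proof.
  intros HK Hx n d Hn.
  assert (H : (Cmod (x (n + d)%nat - x n) <= K / (1 - th) * th ^ n * (1 - th ^ d))%R).
  { induction d as [|d IH].
    - rewrite Nat.add_0_r; replace (x n - x n) with (RtoC 0) by ring; rewrite Cmod_0; simpl; lra.
    - rewrite Nat.add_succ_r.
      replace (x (S (n + d)) - x n) with ((x (S (n + d)) - x (n + d)%nat) + (x (n + d)%nat - x n))
        by ring.
      eapply Rle_trans; [apply Cmod_triangle|].
      specialize (Hx (n + d)%nat ltac:(lia)); rewrite pow_add in Hx.
      replace (K / (1 - th) * th ^ n * (1 - th ^ S d))%R with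
        (K * (th ^ n * th ^ d) + K / (1 - th) * th ^ n * (1 - th ^ d))%R
        by (simpl pow; field; lra).
      lra. }
  eapply Rle_trans; [exact H|].
  assert (0 <= K / (1 - th) * th ^ n)%R.
  { apply Rmult_le_pos; [|apply pow_le; lra].
    apply Rmult_le_pos; trivial; left; apply Rinv_0_lt_compat; lra. }
  assert (0 <= th ^ d)%R by (apply pow_le; lra); nra.
Qed.

Definition C_cv (x : nat -> C) (l : C) : Prop :=
  forall eps : R, (0 < eps)%R -> exists n0, forall n, (n0 <= n)%nat -> (Cmod (x n - l) < eps)%R.

Lemma geometric_small (K eps : R) : (0 <= K)%R -> (0 < eps)%R ->
  exists n0, forall n, (n0 <= n)%nat -> (K * th ^ n < eps)%R.
Proof.
  intros HK Heps.
  destruct (pow_lt_1_zero th ltac:(rewrite Rabs_pos_eq; lra) (eps / (K + 1))) as [n0 Hn0].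
  { apply Rdiv_lt_0_compat; lra. }
  exists n0; intros n Hn; specialize (Hn0 n Hn).
  assert (Hp : (0 <= th ^ n)%R) by (apply pow_le; lra).
  rewrite Rabs_pos_eq in Hn0 by assumption.
  apply Rle_lt_trans with ((K + 1) * th ^ n)%R; [nra|].
  replace eps with ((K + 1) * (eps / (K + 1)))%R by (field; lra).
  apply Rmult_lt_compat_l; lra.
Qed.

Lemma Cmod_le_Re_Im (z : C) : (Cmod z <= Rabs (Re z) + Rabs (Im z))%R.
Proof.
  destruct z as [a b]; replace (a, b) with (RtoC a + Ci * RtoC b).
  - eapply Rle_trans; [apply Cmod_triangle|].
    rewrite Cmod_mult, Cmod_Ci, !Cmod_R; simpl.
    replace (a + (0 * b - 1 * 0))%R with a by ring.
    replace (0 + (0 * 0 + 1 * b))%R with b by ring; lra.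
  - unfold Cplus, Cmult, Ci, RtoC; simpl; f_equal; ring.
Qed.

Lemma Rabs_Im_le_Cmod (z : C) : (Rabs (Im z) <= Cmod z)%R.
Proof. eapply Rle_trans; [|apply Rmax_Cmod]; apply Rmax_r. Qed.

Lemma geometric_cv (x : nat -> C) (K : R) (N : nat) : (0 <= K)%R ->
  (forall n, (N <= n)%nat -> (Cmod (x (S n) - x n) <= K * th ^ n)%R) ->
  exists l, C_cv x l.
Proof.
  intros HK Hx.
  assert (HKp : (0 <= K / (1 - th))%R).
  { apply Rmult_le_pos; trivial; left; apply Rinv_0_lt_compat; lra. }
  assert (HC : forall eps, (0 < eps)%R -> exists n0, forall n m, (n >= n0)%nat -> (m >= n0)%nat ->
    (Cmod (x n - x m) < eps)%R).
  { intros eps Heps; destruct (geometric_small (K / (1 - th)) eps HKp Heps) as [n1 Hn1].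
    exists (N + n1)%nat.
    assert (H : forall n d, (n >= N + n1)%nat -> (Cmod (x (n + d)%nat - x n) < eps)%R).
    { intros n d Hn; eapply Rle_lt_trans; [apply (geometric_tail x K N); trivial; lia|].
      apply Hn1; lia. }
    intros n m Hn Hm; destruct (Nat.le_gt_cases n m).
    - rewrite Cmod_sub_sym; replace m with (n + (m - n))%nat by lia; now apply H.
    - replace n with (m + (n - m))%nat by lia; now apply H. }
  destruct (Rcomplete.R_complete (fun n => Re (x n))) as [a Ha].
  { intros eps Heps; destruct (HC eps Heps) as [n0 Hn0]; exists n0; intros n m Hn Hm.
    unfold Rdist; eapply Rle_lt_trans; [|now apply (Hn0 n m)].
    exact (re_le_Cmod (x n - x m)). }
  destruct (Rcomplete.R_complete (fun n => Im (x n))) as [b Hb].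
  { intros eps Heps; destruct (HC eps Heps) as [n0 Hn0]; exists n0; intros n m Hn Hm.
    unfold Rdist; eapply Rle_lt_trans; [|now apply (Hn0 n m)].
    exact (Rabs_Im_le_Cmod (x n - x m)). }
  exists (a, b); intros eps Heps.
  destruct (Ha (eps / 2)%R ltac:(lra)) as [n1 Hn1].
  destruct (Hb (eps / 2)%R ltac:(lra)) as [n2 Hn2].
  exists (n1 + n2)%nat; intros n Hn.
  specialize (Hn1 n ltac:(lia)); specialize (Hn2 n ltac:(lia)); unfold Rdist in *.
  eapply Rle_lt_trans; [apply Cmod_le_Re_Im|].
  change (Re (x n - (a, b))) with (Re (x n) - a)%R.
  change (Im (x n - (a, b))) with (Im (x n) - b)%R; lra.
Qed.

Lemma geometric_limit_tail (x : nat -> C) (K : R) (N : nat) (l : C) : (0 <= K)%R ->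
  (forall n, (N <= n)%nat -> (Cmod (x (S n) - x n) <= K * th ^ n)%R) ->
  C_cv x l -> forall n, (N <= n)%nat -> (Cmod (l - x n) <= K / (1 - th) * th ^ n)%R.
Proof.
  intros HK Hx Hl n Hn; apply Rle_plus_epsilon; intros eps Heps.
  destruct (Hl eps Heps) as [n0 Hn0].
  pose proof (geometric_tail x K N HK Hx n n0 Hn) as G.
  specialize (Hn0 (n + n0)%nat ltac:(lia)); rewrite Cmod_sub_sym in Hn0.
  replace (l - x n) with ((l - x (n + n0)%nat) + (x (n + n0)%nat - x n)) by ring.
  eapply Rle_trans; [apply Cmod_triangle|lra].
Qed.

Lemma C_cv_minus (x y : nat -> C) (a b : C) :
  C_cv x a -> C_cv y b -> C_cv (fun n => x n - y n) (a - b).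
Proof.
  intros Ha Hb eps Heps.
  destruct (Ha (eps / 2)%R ltac:(lra)) as [n1 Hn1].
  destruct (Hb (eps / 2)%R ltac:(lra)) as [n2 Hn2].
  exists (n1 + n2)%nat; intros n Hn.
  specialize (Hn1 n ltac:(lia)); specialize (Hn2 n ltac:(lia)).
  replace (x n - y n - (a - b)) with ((x n - a) + - (y n - b)) by ring.
  eapply Rle_lt_trans; [apply Cmod_triangle|]; rewrite Cmod_opp; lra.
Qed.

(** Geometrically small Lipschitz constants for the increments take the place
    of Weierstrass' theorem: no Cauchy integral is needed. *)
Lemma geometric_limit_derivable (D : C -> Prop) (F : nat -> C -> C) (f : C -> C)
    (K : R) (N : nat) (z : C) : (0 <= K)%R ->
  D z -> (exists r, (0 < r)%R /\ forall w, (Cmod (w - z) < r)%R -> D w) ->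
  (forall w, D w -> C_cv (fun n => F n w) (f w)) ->
  (forall n, (N <= n)%nat -> C_derivable (F n) z) ->
  (forall n w w', (N <= n)%nat -> D w -> D w' ->
    (Cmod ((F (S n) w - F n w) - (F (S n) w' - F n w')) <= K * th ^ n * Cmod (w - w'))%R) ->
  C_derivable f z.
Proof.
  intros HK Hz [r [Hr HD]] Hf HF Hlip.
  assert (HKp : (0 <= K / (1 - th))%R).
  { apply Rmult_le_pos; trivial; left; apply Rinv_0_lt_compat; lra. }
  set (l := fun n => epsilon (inhabits (RtoC 0)) (C_derivable_to (F n) z)).
  assert (Hl : forall n, (N <= n)%nat -> C_derivable_to (F n) z (l n)).
  { intros n Hn; apply epsilon_spec, HF, Hn. }
  (* The derivatives thus converge geometrically as well, and their limit is the candidate for the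
     derivative. *)
  assert (Hlinc : forall n, (N <= n)%nat -> (Cmod (l (S n) - l n) <= K * th ^ n)%R).
  { intros n Hn.
    apply (derivative_le_lipschitz (fun w => F (S n) w - F n w) z _ r _ Hr).
    - intros w Hw; apply Hlip; auto.
    - apply (@is_derive_minus C_AbsRing C_NormedModule); apply Hl; lia. }
  destruct (geometric_cv l K N HK Hlinc) as [m Hm].
  pose proof (geometric_limit_tail l K N m HK Hlinc Hm) as Htail.
  exists m; apply C_derivable_toE; intros eps Heps.
  destruct (geometric_small (K / (1 - th)) (eps / 3) HKp ltac:(lra)) as [n0 Hn0].
  set (n := (N + n0)%nat).
  specialize (Hn0 n ltac:(unfold n; lia)); specialize (Htail n ltac:(unfold n; lia)).
  assert (Hn : (N <= n)%nat) by (unfold n; lia).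
  pose proof (Hl n Hn) as Hln; rewrite C_derivable_toE in Hln.
  destruct (Hln (eps / 3)%R ltac:(lra)) as [del [Hdel Hd]].
  exists (Rmin r del); split; [now apply Rmin_glb_lt|]; intros w Hw.
  specialize (Hd w (Rlt_le_trans _ _ _ Hw (Rmin_r _ _))).
  assert (HDw : D w) by (apply HD, (Rlt_le_trans _ _ _ Hw (Rmin_l _ _))).
  set (s := Cmod (w - z)) in *.
  assert (Hs : (0 <= s)%R) by apply Cmod_ge_0.
  (* The remainder [f - F n] inherits a small Lipschitz bound at [z], so it contributes at most a
     third of eps |w - z|. *)
  assert (B1 : (Cmod ((f w - f z) - (F n w - F n z)) <= K * s / (1 - th) * th ^ n)%R).
  { apply (geometric_limit_tail (fun k => F k w - F k z) (K * s) N); trivial.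
    - now apply Rmult_le_pos.
    - intros k Hk.
      replace (F (S k) w - F (S k) z - (F k w - F k z)) with
        (F (S k) w - F k w - (F (S k) z - F k z)) by ring.
      eapply Rle_trans; [now apply Hlip|fold s; right; ring].
    - apply C_cv_minus; now apply Hf. }
  replace (f w - f z - (w - z) * m) with
    (((f w - f z) - (F n w - F n z)) +
     ((F n w - F n z - (w - z) * l n) + - ((w - z) * (m - l n)))) by ring.
  eapply Rle_trans; [apply Cmod_triangle|].
  eapply Rle_trans; [apply Rplus_le_compat_l, Cmod_triangle|].
  rewrite Cmod_opp, Cmod_mult; fold s.
  replace (K * s / (1 - th) * th ^ n)%R with (K / (1 - th) * th ^ n * s)%R in B1
    by (unfold Rdiv; ring).
  nra.
Qed.

End GeometricLimit.

(** * Convergence on the sphere and the scaled coefficients *)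

Lemma Cmod_lt_locally (z : C) (r : R) (P : C -> Prop) : (0 < r)%R ->
  (forall w, (Cmod (w - z) < r)%R -> P w) -> locally z P.
Proof.
  intros Hr H; apply (@locally_le_locally_norm C_AbsRing C_NormedModule).
  exists (mkposreal r Hr); intros w Hw; apply H, Hw.
Qed.

Lemma locally_Cmod_lt (z : C) (P : C -> Prop) : locally z P ->
  exists r, (0 < r)%R /\ forall w, (Cmod (w - z) < r)%R -> P w.
Proof.
  intros [r H]; exists r; split; [apply cond_pos|].
  intros w Hw; apply H, C_NormedModule_mixin_compat1, Hw.
Qed.

(** The sphere is Hausdorff: discs of half the distance separate finite points, and a unit disc and
    its complement separate its centre from infinity. This identifies the value that [CF] picks by
    [epsilon]. *)
Lemma is_CF_unique (a b : nat -> C) (v v' : sphere) :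
  is_CF a b v -> is_CF a b v' -> v = v'.
Proof.
  intros [_ H] [_ H'].
  assert (Hsep : forall P : sphere -> Prop, sphere_locally v P ->
    sphere_locally v' (fun x => ~ P x) -> False).
  { intros P HP HP'; destruct (H _ HP) as [n Hn]; destruct (H' _ HP') as [n' Hn'].
    apply (Hn' (n + n')%nat ltac:(lia)), Hn; lia. }
  assert (Hfin : forall z, sphere_locally (Some z)
    (fun x => match x with Some w => (Cmod (w - z) < 1)%R | None => False end)).
  { intros z; apply (Cmod_lt_locally z 1); [lra|trivial]. }
  assert (Hinf : forall z, sphere_locally None
    (fun x => ~ match x with Some w => (Cmod (w - z) < 1)%R | None => False end)).
  { intros z; split; [tauto|]; exists (Cmod z + 1)%R; intros w Hw Hw'.
    pose proof (Cmod_triangle_sub w z); lra. }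
  destruct v as [z|], v' as [z'|]; trivial.
  - destruct (Ceq_dec z z') as [->|Hne]; trivial; exfalso.
    assert (Hd : (0 < Cmod (z - z'))%R) by now apply Cmod_gt_0, Cminus_eq_contra.
    apply (Hsep (fun x => match x with Some w => (Cmod (w - z) < Cmod (z - z') / 2)%R
      | None => False end)).
    + apply (Cmod_lt_locally z (Cmod (z - z') / 2)); [lra|trivial].
    + apply (Cmod_lt_locally z' (Cmod (z - z') / 2)); [lra|]; intros w Hw Hw'.
      pose proof (Cmod_triangle_sub (z - z') (w - z')) as T.
      replace (z - z' - (w - z')) with (z - w) in T by ring.
      rewrite (Cmod_sub_sym z w) in T; lra.
  - exfalso; exact (Hsep _ (Hfin z) (Hinf z)).
  - exfalso; apply (Hsep _ (Hinf z')).
    eapply filter_imp; [|exact (Hfin z')]; intros w Hw HN; exact (HN Hw).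
Qed.

(** The ratios [B / A] are the ones under control, because the numerators are known not to vanish; a
    limit 0 corresponds to the value infinity of the fraction. *)
Lemma is_CF_of_reciprocal_limit (a b : nat -> C) (l : C) (N : nat) :
  (forall n, (N <= n)%nat -> CF_A a b n <> 0) ->
  C_cv (fun n => CF_B a b n / CF_A a b n) l ->
  exists v, is_CF a b v /\ sphere_inv v = Some l.
Proof.
  intros HA Hl.
  set (A := CF_A a b) in *; set (B := CF_B a b) in *.
  assert (Hev : eventually (fun n => A n <> 0 \/ B n <> 0)).
  { exists N; intros n Hn; left; now apply HA. }
  destruct (Ceq_dec l 0) as [->|Hl0].
  - exists None; split; [|reflexivity]; split; trivial.
    intros P [HP [M HM]].
    set (M' := (Rabs M + 1)%R).
    assert (HM' : (0 < M')%R) by (pose proof (Rabs_pos M); unfold M'; lra).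
    destruct (Hl (/ M')%R) as [n0 Hn0]; [now apply Rinv_0_lt_compat|].
    exists (N + n0)%nat; intros n Hn; unfold sphere_div; fold A; fold B.
    (* If [B n] vanishes, the convergent is infinity itself. *)
    destruct (Ceq_dec (B n) 0) as [_|HB]; trivial.
    apply HM.
    specialize (HA n ltac:(lia)); specialize (Hn0 n ltac:(lia)).
    replace (B n / A n - 0) with (B n / A n) in Hn0 by ring.
    assert (H1 : (0 < Cmod (B n / A n))%R).
    { apply Cmod_gt_0; intros E; apply HB.
      replace (B n) with (B n / A n * A n) by (field; trivial); rewrite E; ring. }
    replace (A n / B n) with (/ (B n / A n)) by (field; split; trivial).
    rewrite Cmod_inv by now apply Cmod_gt_0.
    apply Rlt_trans with M'; [pose proof (Rle_abs M); unfold M'; lra|].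
    rewrite <- (Rinv_inv M'); apply Rinv_lt_contravar; trivial.
    apply Rmult_lt_0_compat; trivial; now apply Rinv_0_lt_compat.
  - exists (Some (/ l)); split.
    2:{ simpl; unfold sphere_div; destruct (Ceq_dec (/ l) 0) as [E|_].
        - exfalso; apply C1_nz; rewrite <- (Cinv_r l), E by trivial; ring.
        - f_equal; field; assumption. }
    split; trivial; intros P HP.
    destruct (locally_Cmod_lt _ _ HP) as [r [Hr HrP]].
    assert (Hlm : (0 < Cmod l)%R) by now apply Cmod_gt_0.
    set (m := Cmod l) in *.
    destruct (Hl (Rmin (m / 2) (r * m ^ 2 / 2))) as [n0 Hn0].
    { apply Rmin_glb_lt; [lra|]; apply Rdiv_lt_0_compat; [|lra].
      apply Rmult_lt_0_compat; [lra|now apply pow_lt]. }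
    exists (N + n0)%nat; intros n Hn; unfold sphere_div; fold A; fold B.
    specialize (HA n ltac:(lia)); specialize (Hn0 n ltac:(lia)); simpl in Hn0.
    set (F := B n / A n) in *.
    pose proof (Rlt_le_trans _ _ _ Hn0 (Rmin_l _ _)) as W1.
    pose proof (Rlt_le_trans _ _ _ Hn0 (Rmin_r _ _)) as W2.
    pose proof (Cmod_triangle_sub l F) as T; rewrite (Cmod_sub_sym l F) in T; fold m in T.
    assert (HFm : (m / 2 < Cmod F)%R) by lra.
    assert (HF0 : F <> 0) by (apply Cmod_gt_0; lra).
    destruct (Ceq_dec (B n) 0) as [HB|HB].
    { exfalso; apply HF0; unfold F; rewrite HB; unfold Cdiv; ring. }
    apply HrP.
    replace (A n / B n) with (/ F) by (unfold F; field; split; trivial).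
    replace (/ F - / l) with ((l - F) * / (F * l)) by (field; split; trivial).
    rewrite Cmod_mult, Cmod_inv, Cmod_mult by now apply Cmult_neq_0.
    rewrite (Cmod_sub_sym l F); fold m.
    apply (Rmult_lt_reg_r (Cmod F * m)); [apply Rmult_lt_0_compat; lra|].
    rewrite Rmult_assoc, Rinv_l, Rmult_1_r
      by (apply Rgt_not_eq, Rmult_lt_0_compat; lra).
    apply (Rlt_le_trans _ _ _ W2).
    replace (r * (m * (m * 1)) / 2)%R with (r * (m / 2 * m))%R by field.
    apply Rmult_le_compat_l; [lra|]; apply Rmult_le_compat_r; lra.
Qed.

Lemma CF_sphere_inv (a b : nat -> C) (v : sphere) (l : C) :
  is_CF a b v -> sphere_inv v = Some l -> sphere_inv (CF a b) = Some l.
Proof.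
  intros Hv <-; f_equal; apply (is_CF_unique a b); trivial.
  unfold CF; apply epsilon_spec; now exists v.
Qed.

(** Serves both for [bounded_lipschitz] and for [C_derivable]. *)
Lemma CF_rec_closed (Phi : (C -> C) -> Prop) (a b : nat -> C -> C) (x0 x1 : C -> C) :
  (forall f g, Phi f -> Phi g -> Phi (fun z => f z + g z)) ->
  (forall f g, Phi f -> Phi g -> Phi (fun z => f z * g z)) ->
  (forall n, Phi (a n)) -> (forall n, Phi (b n)) -> Phi x0 -> Phi x1 ->
  forall n, Phi (fun z => CF_rec (fun k => a k z) (fun k => b k z) (x0 z) (x1 z) n).
Proof.
  intros Hp Hm Ha Hb H0 H1.
  assert (H : forall n,
    Phi (fun z => CF_rec (fun k => a k z) (fun k => b k z) (x0 z) (x1 z) n) /\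
    Phi (fun z => CF_rec (fun k => a k z) (fun k => b k z) (x0 z) (x1 z) (S n))).
  2:{ intros n; now destruct (H n). }
  induction n as [|n [IH1 IH2]]; [split; assumption|]; split; trivial.
  apply (Hp (fun z => a (S n) z * _) (fun z => b (S n) z * _)); apply Hm; trivial.
Qed.

(** * The recurrence after division by (n!)^2 *)

Definition scaled_a (al be : C) (n : nat) : C :=
  H_a al be n / (INR (S n) * INR (S n)).
(** The sign gives the recurrence the form y'' = P y' - Q y, with limit 2 for Q. At [n = 0] there is
    a division by zero; only positive indices occur. *)
Definition scaled_b (al be ga : C) (n : nat) : C :=
  - H_b al be ga n / (INR n * INR n * (INR (S n) * INR (S n))).
Definition fact_scaled (x : nat -> C) (n : nat) : C :=
  x n * / (INR (fact n) * INR (fact n)).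

Lemma INR_S_neq_0_C (n : nat) : RtoC (INR (S n)) <> 0.
Proof. intros E; apply RtoC_inj in E; now apply not_0_INR in E. Qed.

Lemma INR_fact_neq_0_C (n : nat) : RtoC (INR (fact n)) <> 0.
Proof. intros E; apply RtoC_inj in E; now apply INR_fact_neq_0 in E. Qed.

Lemma fact_scaled_rec (al be ga x0 x1 : C) (n : nat) :
  let x := fact_scaled (CF_rec (H_a al be) (H_b al be ga) x0 x1) in
  x (S (S n)) = scaled_a al be (S n) * x (S n) - scaled_b al be ga (S n) * x n.
Proof.
  cbv zeta; unfold fact_scaled, scaled_a, scaled_b.
  rewrite (fact_simpl (S n)), (fact_simpl n), !INR_mul_C.
  change (CF_rec (H_a al be) (H_b al be ga) x0 x1 (S (S n))) with
    (H_a al be (S n) * CF_rec (H_a al be) (H_b al be ga) x0 x1 (S n) +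
     H_b al be ga (S n) * CF_rec (H_a al be) (H_b al be ga) x0 x1 n).
  field; repeat split; try apply INR_S_neq_0_C; apply INR_fact_neq_0_C.
Qed.

(** A polynomial in 1/(n+2), affine in each parameter, with the limit 3 split off: closeness to 3
    and the Lipschitz bound are both read off from it. *)
Lemma scaled_a_expand (al be : C) (n : nat) :
  let s := RtoC (/ INR (S (S n))) in
  scaled_a al be (S n) =
  3 + s * (-(6) + 3 * s + (3 + 2 * al + 2 * be) * (1 - s) + (1 + al) * (1 + be) * s).
Proof.
  cbv zeta; unfold scaled_a, H_a, Defs.Delta.
  rewrite RtoC_inv by now apply not_0_INR.
  pose proof (INR_S_neq_0_C (S n)) as H; rewrite !INR_S_C in *; field.
  intros E; apply H; rewrite <- E; ring.
Qed.

Lemma scaled_b_expand (al be ga : C) (n : nat) :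
  let r := RtoC (/ INR (S n)) in let s := RtoC (/ INR (S (S n))) in
  scaled_b al be ga (S n) = 2 * ((1 + r * al) * (1 + s * (be - 1)) * (1 + s * (ga - 1))).
Proof.
  cbv zeta; unfold scaled_b, H_b.
  rewrite !RtoC_inv by now apply not_0_INR.
  pose proof (INR_S_neq_0_C (S n)) as H; pose proof (INR_S_neq_0_C n) as H'.
  rewrite !INR_S_C in *; field.
  split; assumption.
Qed.

Lemma Cmod_real_scale (r : R) (z : C) : (0 <= r)%R -> Cmod (r * z) = (r * Cmod z)%R.
Proof. intros H; rewrite Cmod_mult, Cmod_R, Rabs_pos_eq; trivial. Qed.

Lemma inv_INR_S_bound (n : nat) : (0 <= / INR (S n) <= 1)%R.
Proof.
  assert (1 <= INR (S n))%R by (change 1%R with (INR 1); apply le_INR; lia).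
  split; [left; apply Rinv_0_lt_compat; lra|].
  rewrite <- Rinv_1; apply Rinv_le_contravar; lra.
Qed.

Lemma inv_INR_SS_le (n : nat) : (/ INR (S (S n)) <= / INR (S n))%R.
Proof. apply Rinv_le_contravar; [apply lt_0_INR; lia|apply le_INR; lia]. Qed.

Lemma scaled_a_near (R0 : R) (al be : C) (n : nat) :
  (Cmod al <= R0)%R -> (Cmod be <= R0)%R ->
  (Cmod (scaled_a al be (S n) - 3) <= (R0 + 4) ^ 2 * / INR (S n))%R.
Proof.
  intros Ha Hb; rewrite scaled_a_expand; cbv zeta.
  pose proof (inv_INR_S_bound (S n)) as Hs; pose proof (inv_INR_SS_le n) as Hsr.
  set (r := (/ INR (S n))%R) in *; set (s := (/ INR (S (S n)))%R) in *.
  pose proof (Cmod_ge_0 al); pose proof (Cmod_ge_0 be).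
  set (G := -(6) + 3 * s + (3 + 2 * al + 2 * be) * (1 - s) + (1 + al) * (1 + be) * s).
  replace (3 + s * G - 3) with (s * G) by ring.
  rewrite Cmod_real_scale by lra.
  assert (HG : (Cmod G <= (R0 + 4) ^ 2)%R).
  { assert (E : G = RtoC (- 3 * (1 - s) - 2 * s) + (RtoC (2 * (1 - s) + s) * al
      + (RtoC (2 * (1 - s) + s) * be + s * (al * be)))).
    { unfold G; rewrite ?RtoC_plus, ?RtoC_minus, ?RtoC_mult, ?RtoC_plus, ?RtoC_minus,
        ?RtoC_mult; ring. }
    rewrite E.
    eapply Rle_trans; [apply Cmod_triangle|].
    eapply Rle_trans; [apply Rplus_le_compat_l, Cmod_triangle|].
    eapply Rle_trans; [apply Rplus_le_compat_l, Rplus_le_compat_l, Cmod_triangle|].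
    rewrite !Cmod_real_scale, Cmod_mult, Cmod_R by lra.
    rewrite Rabs_left1 by lra.
    assert (Cmod al * Cmod be <= R0 * R0)%R by (apply Rmult_le_compat; lra).
    assert (0 <= Cmod al * Cmod be)%R by (apply Rmult_le_pos; lra).
    nra. }
  pose proof (Cmod_ge_0 G); rewrite Rmult_comm; apply Rmult_le_compat; lra.
Qed.

Lemma scaled_a_lipschitz (R0 del : R) (al be al' be' : C) (n : nat) :
  (Cmod al' <= R0)%R -> (Cmod be <= R0)%R ->
  (Cmod (al - al') <= del)%R -> (Cmod (be - be') <= del)%R ->
  (Cmod (scaled_a al be (S n) - scaled_a al' be' (S n)) <= (2 * R0 + 6) * del)%R.
Proof.
  intros Ha Hb Hda Hdb; rewrite !scaled_a_expand; cbv zeta.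
  pose proof (inv_INR_S_bound (S n)) as Hs.
  set (s := (/ INR (S (S n)))%R) in *.
  match goal with |- (Cmod ?g <= _)%R => replace g with
    (RtoC (s * (2 * (1 - s) + s)) * (al - al') + (RtoC (s * (2 * (1 - s) + s)) * (be - be')
      + RtoC (s * s) * ((al - al') * be + al' * (be - be')))) end.
  2:{ rewrite ?RtoC_mult, ?RtoC_plus, ?RtoC_mult, ?RtoC_minus; ring. }
  eapply Rle_trans; [apply Cmod_triangle|].
  eapply Rle_trans; [apply Rplus_le_compat_l, Cmod_triangle|].
  rewrite !Cmod_real_scale by nra.
  assert (E : (Cmod ((al - al') * be + al' * (be - be')) <= 2 * R0 * del)%R).
  { eapply Rle_trans; [apply Cmod_triangle|]; rewrite !Cmod_mult.
    assert (Cmod (al - al') * Cmod be <= del * R0)%R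
      by (apply Rmult_le_compat; try apply Cmod_ge_0; lra).
    assert (Cmod al' * Cmod (be - be') <= R0 * del)%R
      by (apply Rmult_le_compat; try apply Cmod_ge_0; lra).
    lra. }
  pose proof (Cmod_ge_0 ((al - al') * be + al' * (be - be'))).
  pose proof (Cmod_ge_0 (al - al')); pose proof (Cmod_ge_0 (be - be')).
  assert (0 <= s * (2 * (1 - s) + s) <= 2)%R by nra.
  assert (0 <= s * s <= 1)%R by nra.
  nra.
Qed.

Lemma near_one_bound (R0 r : R) (z : C) : (0 <= r <= 1)%R -> (Cmod z <= R0)%R ->
  (Cmod (1 + r * z) <= R0 + 1)%R.
Proof.
  intros Hr Hz; eapply Rle_trans; [apply Cmod_triangle|].
  rewrite Cmod_real_scale, Cmod_1 by lra; pose proof (Cmod_ge_0 z); nra.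
Qed.

Lemma Cmod_sub_1_le (R0 : R) (z : C) : (Cmod z <= R0)%R -> (Cmod (z - 1) <= R0 + 1)%R.
Proof.
  intros Hz; eapply Rle_trans; [apply Cmod_triangle|]; rewrite Cmod_opp, Cmod_1; lra.
Qed.

Lemma product3_lipschitz (B dx dy dz : R) (x y z x' y' z' : C) :
  (Cmod y <= B)%R -> (Cmod z <= B)%R -> (Cmod x' <= B)%R -> (Cmod y' <= B)%R ->
  (Cmod (x - x') <= dx)%R -> (Cmod (y - y') <= dy)%R -> (Cmod (z - z') <= dz)%R ->
  (Cmod (x * y * z - x' * y' * z') <= (dx + dy + dz) * B ^ 2)%R.
Proof.
  intros Hy Hz Hx' Hy' Hdx Hdy Hdz.
  replace (x * y * z - x' * y' * z') with
    ((x - x') * (y * z) + ((y - y') * (x' * z) + (z - z') * (x' * y'))) by ring.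
  eapply Rle_trans; [apply Cmod_triangle|].
  eapply Rle_trans; [apply Rplus_le_compat_l, Cmod_triangle|].
  assert (H : forall d a b D, (Cmod d <= D)%R -> (Cmod a <= B)%R -> (Cmod b <= B)%R ->
    (Cmod (d * (a * b)) <= D * B ^ 2)%R).
  { intros d a b D Hd Ha Hb; rewrite !Cmod_mult.
    replace (B ^ 2)%R with (B * B)%R by ring.
    apply Rmult_le_compat; try apply Cmod_ge_0; trivial.
    - apply Rmult_le_pos; apply Cmod_ge_0.
    - apply Rmult_le_compat; try apply Cmod_ge_0; trivial. }
  pose proof (H (x - x') y z dx Hdx Hy Hz).
  pose proof (H (y - y') x' z dy Hdy Hx' Hz).
  pose proof (H (z - z') x' y' dz Hdz Hx' Hy').
  lra.
Qed.

Lemma scaled_b_near (R0 : R) (al be ga : C) (n : nat) :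
  (Cmod al <= R0)%R -> (Cmod be <= R0)%R -> (Cmod ga <= R0)%R ->
  (Cmod (scaled_b al be ga (S n) - 2) <= 6 * (R0 + 2) ^ 3 * / INR (S n))%R.
Proof.
  intros Ha Hb Hc; rewrite scaled_b_expand; cbv zeta.
  pose proof (inv_INR_S_bound (S n)) as Hs; pose proof (inv_INR_S_bound n) as Hr.
  pose proof (inv_INR_SS_le n) as Hsr.
  set (r := (/ INR (S n))%R) in *; set (s := (/ INR (S (S n)))%R) in *.
  apply Cmod_sub_1_le in Hb; apply Cmod_sub_1_le in Hc.
  pose proof (Cmod_ge_0 al); pose proof (Cmod_ge_0 (be - 1)); pose proof (Cmod_ge_0 (ga - 1)).
  assert (E : forall t z, (0 <= t <= r)%R -> (Cmod z <= R0 + 1)%R ->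
    (Cmod (1 + t * z - 1) <= r * (R0 + 2))%R).
  { intros t z Ht Hz; replace (1 + t * z - 1) with (t * z) by ring.
    pose proof (Cmod_ge_0 z).
    rewrite Cmod_real_scale by lra; apply Rmult_le_compat; lra. }
  set (G := (1 + r * al) * (1 + s * (be - 1)) * (1 + s * (ga - 1))).
  replace (2 * G - 2) with (2 * (G - 1 * 1 * 1)) by ring.
  rewrite Cmod_real_scale by lra.
  assert (HG : (Cmod (G - 1 * 1 * 1) <=
    (r * (R0 + 2) + r * (R0 + 2) + r * (R0 + 2)) * (R0 + 2) ^ 2)%R).
  { apply product3_lipschitz; try apply E; try (rewrite Cmod_1; lra); try lra.
    - eapply Rle_trans; [apply (near_one_bound (R0 + 1))|]; lra.
    - eapply Rle_trans; [apply (near_one_bound (R0 + 1))|]; lra. }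
  eapply Rle_trans; [apply Rmult_le_compat_l; [lra|exact HG]|].
  right; ring.
Qed.

Lemma scaled_b_lipschitz (R0 del : R) (al be ga al' be' ga' : C) (n : nat) :
  (Cmod be <= R0)%R -> (Cmod ga <= R0)%R -> (Cmod al' <= R0)%R -> (Cmod be' <= R0)%R ->
  (Cmod (al - al') <= del)%R -> (Cmod (be - be') <= del)%R -> (Cmod (ga - ga') <= del)%R ->
  (Cmod (scaled_b al be ga (S n) - scaled_b al' be' ga' (S n)) <= 6 * (R0 + 2) ^ 2 * del)%R.
Proof.
  intros Hb Hc Ha' Hb' Hda Hdb Hdc; rewrite !scaled_b_expand; cbv zeta.
  pose proof (inv_INR_S_bound (S n)) as Hs; pose proof (inv_INR_S_bound n) as Hr.
  set (r := (/ INR (S n))%R) in *; set (s := (/ INR (S (S n)))%R) in *.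
  apply Cmod_sub_1_le in Hb; apply Cmod_sub_1_le in Hc; apply Cmod_sub_1_le in Hb'.
  assert (E : forall t z z' : C, forall q : R, (0 <= q <= 1)%R -> (Cmod (z - z') <= del)%R ->
    (Cmod (1 + q * (z - t) - (1 + q * (z' - t))) <= del)%R).
  { intros t z z' q Hq Hz.
    replace (1 + q * (z - t) - (1 + q * (z' - t))) with (q * (z - z')) by ring.
    pose proof (Cmod_ge_0 (z - z')); rewrite Cmod_real_scale by lra; nra. }
  assert (Hfac : forall g h : C, 2 * g - 2 * h = 2 * (g - h)) by (intros; ring).
  rewrite Hfac.
  rewrite Cmod_real_scale by lra.
  replace (6 * (R0 + 2) ^ 2 * del)%R with (2 * ((del + del + del) * (R0 + 2) ^ 2))%R by ring.
  apply Rmult_le_compat_l; [lra|].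
  apply product3_lipschitz.
  - eapply Rle_trans; [apply (near_one_bound (R0 + 1))|]; lra.
  - eapply Rle_trans; [apply (near_one_bound (R0 + 1))|]; lra.
  - eapply Rle_trans; [apply (near_one_bound R0)|]; lra.
  - eapply Rle_trans; [apply (near_one_bound (R0 + 1))|]; lra.
  - pose proof (E 0 al al' r Hr Hda) as H.
    now replace (al - 0) with al in H by ring; replace (al' - 0) with al' in H by ring.
  - now apply E.
  - now apply E.
Qed.

(** * Regularity *)

Lemma C_derivable_minus (f g : C -> C) (z : C) :
  C_derivable f z -> C_derivable g z -> C_derivable (fun w => f w - g w) z.
Proof.
  intros [l Hl] [m Hm]; exists (l - m).
  now apply (@is_derive_minus C_AbsRing C_NormedModule).
Qed.

Section Closure.

Variables (Phi : (C -> C) -> Prop) (pa pb pc : C -> C).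
Hypothesis Phi_const : forall c, Phi (fun _ => c).
Hypothesis Phi_plus : forall f g, Phi f -> Phi g -> Phi (fun z => f z + g z).
Hypothesis Phi_minus : forall f g, Phi f -> Phi g -> Phi (fun z => f z - g z).
Hypothesis Phi_mult : forall f g, Phi f -> Phi g -> Phi (fun z => f z * g z).
Hypothesis Phi_pa : Phi pa.
Hypothesis Phi_pb : Phi pb.
Hypothesis Phi_pc : Phi pc.

Lemma H_a_closed (n : nat) : Phi (fun z => H_a (pa z) (pb z) n).
Proof.
  unfold H_a, Defs.Delta; apply Phi_minus; repeat apply Phi_mult; try apply Phi_const;
  now apply Phi_plus.
Qed.

Lemma H_b_closed (n : nat) : Phi (fun z => H_b (pa z) (pb z) (pc z) n).
Proof.
  unfold H_b; repeat apply Phi_mult; try apply Phi_const; now apply Phi_plus.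
Qed.

Lemma convergents_closed (n : nat) :
  Phi (fun z => fact_scaled (CF_A (H_a (pa z) (pb z)) (H_b (pa z) (pb z) (pc z))) n) /\
  Phi (fun z => fact_scaled (CF_B (H_a (pa z) (pb z)) (H_b (pa z) (pb z) (pc z))) n).
Proof.
  split; apply Phi_mult; try apply Phi_const.
  - apply (CF_rec_closed Phi (fun n z => H_a (pa z) (pb z) n)
      (fun n z => H_b (pa z) (pb z) (pc z) n) (fun _ => 1) (fun z => H_a (pa z) (pb z) 0));
    auto using H_a_closed, H_b_closed.
  - apply (CF_rec_closed Phi (fun n z => H_a (pa z) (pb z) n)
      (fun n z => H_b (pa z) (pb z) (pc z) n) (fun _ => 0) (fun _ => 1));
    auto using H_a_closed, H_b_closed.
Qed.

End Closure.

Lemma fact_scaled_ratio (x y : nat -> C) (n : nat) : y n <> 0 ->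
  fact_scaled x n / fact_scaled y n = x n / y n.
Proof.
  intros Hy; unfold fact_scaled; field; split; trivial; apply INR_fact_neq_0_C.
Qed.

Lemma fact_scaled_neq_0 (x : nat -> C) (n : nat) : fact_scaled x n <> 0 -> x n <> 0.
Proof. intros H E; apply H; unfold fact_scaled; rewrite E; ring. Qed.

(** * Regularity along a curve in the space of parameters *)

Section Curve.

Variables (pa pb pc : C -> C) (z0 : C).
Hypothesis pa_lip : forall z z', (Cmod (pa z - pa z') <= Cmod (z - z'))%R.
Hypothesis pb_lip : forall z z', (Cmod (pb z - pb z') <= Cmod (z - z'))%R.
Hypothesis pc_lip : forall z z', (Cmod (pc z - pc z') <= Cmod (z - z'))%R.
Hypothesis pa_der : forall z, C_derivable pa z.
Hypothesis pb_der : forall z, C_derivable pb z.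
Hypothesis pc_der : forall z, C_derivable pc z.
Hypothesis domain : H_domain (pa z0) (pb z0) (pc z0).

Let num (n : nat) (z : C) : C :=
  fact_scaled (CF_A (H_a (pa z) (pb z)) (H_b (pa z) (pb z) (pc z))) n.
Let den (n : nat) (z : C) : C :=
  fact_scaled (CF_B (H_a (pa z) (pb z)) (H_b (pa z) (pb z) (pc z))) n.
Let P (n : nat) (z : C) : C := scaled_a (pa z) (pb z) n.
Let Q (n : nat) (z : C) : C := scaled_b (pa z) (pb z) (pc z) n.
Let disc (r : R) (z : C) : Prop := (Cmod (z - z0) < r)%R.

Lemma num_rec (z : C) (n : nat) :
  num (S (S n)) z = P (S n) z * num (S n) z - Q (S n) z * num n z.
Proof. apply fact_scaled_rec. Qed.

Lemma den_rec (z : C) (n : nat) :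
  den (S (S n)) z = P (S n) z * den (S n) z - Q (S n) z * den n z.
Proof. apply fact_scaled_rec. Qed.

Lemma lipschitz_bounded (p : C -> C) (z : C) :
  (forall z z', (Cmod (p z - p z') <= Cmod (z - z'))%R) -> disc 1 z ->
  (Cmod (p z) <= Cmod (p z0) + 1)%R.
Proof.
  intros Hp Hz; unfold disc in Hz; pose proof (Cmod_triangle_sub (p z) (p z0)).
  specialize (Hp z z0); lra.
Qed.

Lemma curve_bounded_lipschitz (p : C -> C) :
  (forall z z', (Cmod (p z - p z') <= Cmod (z - z'))%R) -> bounded_lipschitz (disc 1) p.
Proof.
  intros Hp; pose proof (Cmod_ge_0 (p z0)).
  exists (Cmod (p z0) + 1)%R; split; [lra|]; intros z z' Hz Hz'; split.
  - now apply lipschitz_bounded.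
  - eapply Rle_trans; [apply Hp|]; pose proof (Cmod_ge_0 (z - z')); nra.
Qed.

Lemma convergents_bounded_lipschitz (n : nat) :
  bounded_lipschitz (disc 1) (num n) /\ bounded_lipschitz (disc 1) (den n).
Proof.
  apply (convergents_closed (bounded_lipschitz (disc 1)));
  auto using bounded_lipschitz_const, bounded_lipschitz_plus, bounded_lipschitz_minus,
    bounded_lipschitz_mult, curve_bounded_lipschitz.
Qed.

Lemma convergents_derivable (n : nat) (z : C) :
  C_derivable (num n) z /\ C_derivable (den n) z.
Proof.
  apply (convergents_closed (fun f => C_derivable f z)); trivial.
  - intros c; apply C_derivable_const.
  - intros f g; apply C_derivable_plus.
  - intros f g; apply C_derivable_minus.
  - intros f g; apply C_derivable_mult.
Qed.

Lemma coefficients_near : exists N, forall z n, disc 1 z -> (N <= n)%nat ->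
  (Cmod (P (S n) z - 3) <= / 1000)%R /\ (Cmod (Q (S n) z - 2) <= / 1000)%R.
Proof.
  set (R0 := (Cmod (pa z0) + Cmod (pb z0) + Cmod (pc z0) + 1)%R).
  pose proof (Cmod_ge_0 (pa z0)); pose proof (Cmod_ge_0 (pb z0)); pose proof (Cmod_ge_0 (pc z0)).
  set (K := ((R0 + 4) ^ 2 + 6 * (R0 + 2) ^ 3)%R).
  assert (HR4 : (0 <= (R0 + 4) ^ 2)%R) by apply pow2_ge_0.
  assert (HR2 : (0 <= (R0 + 2) ^ 3)%R) by (apply pow_le; unfold R0; lra).
  destruct (INR_unbounded (1000 * K)) as [N HN]; exists N; intros z n Hz Hn.
  pose proof (lipschitz_bounded pa z pa_lip Hz).
  pose proof (lipschitz_bounded pb z pb_lip Hz).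
  pose proof (lipschitz_bounded pc z pc_lip Hz).
  assert (HS : (1000 * K <= INR (S n))%R).
  { apply Rle_trans with (INR N); [lra|apply le_INR; lia]. }
  assert (Hpos : (0 < INR (S n))%R) by (apply lt_0_INR; lia).
  assert (HK : (K * / INR (S n) <= / 1000)%R).
  { apply (Rmult_le_reg_r (INR (S n))); trivial.
    rewrite Rmult_assoc, Rinv_l, Rmult_1_r by lra; lra. }
  assert (Hinv : (0 < / INR (S n))%R) by now apply Rinv_0_lt_compat.
  split.
  - eapply Rle_trans; [apply (scaled_a_near R0); unfold R0; lra|].
    eapply Rle_trans; [|exact HK]; apply Rmult_le_compat_r; unfold K; lra.
  - eapply Rle_trans; [apply (scaled_b_near R0); unfold R0; lra|].
    eapply Rle_trans; [|exact HK]; apply Rmult_le_compat_r; unfold K; lra.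
Qed.

Lemma coefficients_lipschitz : exists K, (0 <= K)%R /\ forall z z' n, disc 1 z -> disc 1 z' ->
  (Cmod (P (S n) z - P (S n) z') <= K * Cmod (z - z'))%R /\
  (Cmod (Q (S n) z - Q (S n) z') <= K * Cmod (z - z'))%R.
Proof.
  set (R0 := (Cmod (pa z0) + Cmod (pb z0) + Cmod (pc z0) + 1)%R).
  pose proof (Cmod_ge_0 (pa z0)); pose proof (Cmod_ge_0 (pb z0)); pose proof (Cmod_ge_0 (pc z0)).
  assert (HR : (1 <= R0)%R) by (unfold R0; lra).
  assert (HR2 : (0 <= (R0 + 2) ^ 2)%R) by apply pow2_ge_0.
  exists (2 * R0 + 6 + 6 * (R0 + 2) ^ 2)%R; split; [lra|]; intros z z' n Hz Hz'.
  assert (Hb : forall p w, (forall z z', (Cmod (p z - p z') <= Cmod (z - z'))%R) -> disc 1 w ->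
    (Cmod (p z0) + 1 <= R0)%R -> (Cmod (p w) <= R0)%R).
  { intros p w Hp Hw HR'; pose proof (lipschitz_bounded p w Hp Hw); lra. }
  pose proof (Cmod_ge_0 (z - z')); split.
  - eapply Rle_trans; [apply (scaled_a_lipschitz R0 (Cmod (z - z')));
      try (apply Hb; trivial; unfold R0; lra); trivial|].
    apply Rmult_le_compat_r; lra.
  - eapply Rle_trans; [apply (scaled_b_lipschitz R0 (Cmod (z - z')));
      try (apply Hb; trivial; unfold R0; lra); trivial|].
    apply Rmult_le_compat_r; lra.
Qed.

(** Otherwise the numerators would be O(1.01^n (n!)^2). The hypothesis [domain] enters here, at [z0]
    alone; neighbouring points are reached by [cone_nearby]. *)
Lemma in_cone_at_center (N : nat) :
  (forall n, (N <= n)%nat ->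
    (Cmod (P (S n) z0 - 3) <= / 1000)%R /\ (Cmod (Q (S n) z0 - 2) <= / 1000)%R) ->
  exists n, (N <= n)%nat /\
    (Cmod (recessive_part (fun n => num n z0) n) < Cmod (dominant_part (fun n => num n z0) n))%R.
Proof.
  intros HN.
  destruct (classic (exists n, (N <= n)%nat /\
    (Cmod (recessive_part (fun n => num n z0) n) < Cmod (dominant_part (fun n => num n z0) n))%R))
    as [H|H]; trivial; exfalso.
  destruct (never_in_cone (fun n => P n z0) (fun n => Q n z0) (fun n => num n z0) N
    (num_rec z0)) as [K HK].
  - intros n Hn; now apply HN.
  - intros n Hn; now apply HN.
  - intros n Hn; apply Rnot_lt_le; intros Hc; apply H; now exists n.
  - apply (numerators_not_subdominant _ _ _ K domain); intros n; specialize (HK n).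
    unfold num, fact_scaled in HK.
    pose proof (INR_fact_lt_0 n) as Hf.
    rewrite Cmod_mult, Cmod_inv, Cmod_mult, !Cmod_INR in HK
      by (apply Cmult_neq_0; apply INR_fact_neq_0_C).
    apply (Rmult_le_compat_r (INR (fact n) ^ 2)) in HK; [|apply pow2_ge_0].
    replace (Cmod (CF_A (H_a (pa z0) (pb z0)) (H_b (pa z0) (pb z0) (pc z0)) n) *
      / (INR (fact n) * INR (fact n)) * INR (fact n) ^ 2)%R with
      (Cmod (CF_A (H_a (pa z0) (pb z0)) (H_b (pa z0) (pb z0) (pc z0)) n)) in HK
      by (field; lra).
    exact HK.
Qed.

Lemma cone_nearby (n : nat) :
  (Cmod (recessive_part (fun n => num n z0) n) < Cmod (dominant_part (fun n => num n z0) n))%R ->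
  exists r c0, (0 < r <= 1)%R /\ (0 < c0)%R /\ forall z, disc r z ->
  (Cmod (recessive_part (fun n => num n z) n) < Cmod (dominant_part (fun n => num n z) n))%R /\
  (c0 <= Cmod (dominant_part (fun n => num n z) n))%R.
Proof.
  intros Hc.
  pose (u := fun z => dominant_part (fun n => num n z) n).
  pose (w := fun z => recessive_part (fun n => num n z) n).
  assert (Hu : bounded_lipschitz (disc 1) u).
  { apply bounded_lipschitz_minus; apply convergents_bounded_lipschitz. }
  assert (Hw : bounded_lipschitz (disc 1) w).
  { apply bounded_lipschitz_minus; [apply convergents_bounded_lipschitz|].
    apply bounded_lipschitz_mult;
      [apply bounded_lipschitz_const|apply convergents_bounded_lipschitz]. }
  destruct Hu as [Ku [HKu Hu]]; destruct Hw as [Kw [HKw Hw]].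
  set (gap := (Cmod (u z0) - Cmod (w z0))%R).
  assert (Hgap : (0 < gap)%R) by (unfold gap, u, w; lra).
  pose proof (Cmod_ge_0 (w z0)) as Hw0.
  set (K := (Ku + Kw + 1)%R).
  (* In this disc each of the two parts moves by at most [gap / 4], so half of the gap remains, and
     it also bounds the dominant part from below. *)
  exists (Rmin 1 (gap / (4 * K)))%R, (gap / 2)%R.
  assert (HK : (0 < K)%R) by (unfold K; lra).
  split; [split; [apply Rmin_glb_lt; [lra|apply Rdiv_lt_0_compat; lra]|apply Rmin_l]|].
  split; [lra|]; intros z Hz.
  assert (Hz1 : disc 1 z) by (apply (Rlt_le_trans _ _ _ Hz), Rmin_l).
  assert (Hz2 : (Cmod (z - z0) < gap / (4 * K))%R) by (apply (Rlt_le_trans _ _ _ Hz), Rmin_r).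
  assert (Hz0 : disc 1 z0).
  { unfold disc; replace (z0 - z0) with (RtoC 0) by ring; rewrite Cmod_0; lra. }
  destruct (Hu z z0 Hz1 Hz0) as [_ U]; destruct (Hw z z0 Hz1 Hz0) as [_ W].
  assert (HKd : (K * Cmod (z - z0) <= gap / 4)%R).
  { apply Rle_trans with (K * (gap / (4 * K)))%R; [apply Rmult_le_compat_l; lra|].
    right; field; lra. }
  pose proof (Cmod_ge_0 (z - z0)).
  pose proof (Cmod_triangle_sub (u z0) (u z)) as T1; rewrite (Cmod_sub_sym (u z0)) in T1.
  pose proof (Cmod_triangle_sub (w z) (w z0)) as T2.
  assert (HU : (Cmod (u z - u z0) <= gap / 4)%R) by (unfold K in HKd; nra).
  assert (HW : (Cmod (w z - w z0) <= gap / 4)%R) by (unfold K in HKd; nra).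
  fold (u z) (w z); unfold gap in *; split; lra.
Qed.

Lemma reciprocal_limit_derivable : exists (r : R) (f : C -> C), (0 < r)%R /\
  forall z, disc r z -> C_derivable f z /\
    exists v, is_CF (H_a (pa z) (pb z)) (H_b (pa z) (pb z) (pc z)) v /\
      sphere_inv v = Some (f z).
Proof.
  destruct coefficients_near as [N0 Hnear].
  destruct coefficients_lipschitz as [K [HK Hlip]].
  assert (Hz0 : disc 1 z0).
  { unfold disc; replace (z0 - z0) with (RtoC 0) by ring; rewrite Cmod_0; lra. }
  destruct (in_cone_at_center N0 (fun n => Hnear z0 n Hz0)) as [N [HN Hcone]].
  destruct (cone_nearby N Hcone) as [r [c0 [[Hr Hr1] [Hc0 Hnearby]]]].
  assert (Hsub : forall z, disc r z -> disc 1 z).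
  { intros z Hz; exact (Rlt_le_trans _ _ _ Hz Hr1). }
  assert (Hbl : forall f, bounded_lipschitz (disc 1) f -> bounded_lipschitz (disc r) f).
  { intros f [L [HL Hf]]; exists L; split; auto. }
  assert (Pn : forall z n, disc r z -> (N <= n)%nat -> (Cmod (P (S n) z - 3) <= / 1000)%R)
    by (intros z n Hz Hn; apply Hnear; auto; lia).
  assert (Qn : forall z n, disc r z -> (N <= n)%nat -> (Cmod (Q (S n) z - 2) <= / 1000)%R)
    by (intros z n Hz Hn; apply Hnear; auto; lia).
  assert (Hyb : forall n, bounded_lipschitz (disc r) (num n))
    by (intros n; apply Hbl, convergents_bounded_lipschitz).
  assert (Htb : forall n, bounded_lipschitz (disc r) (den n))
    by (intros n; apply Hbl, convergents_bounded_lipschitz).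
  destruct (ratio_increment_bounds (disc r) P Q num den N K c0 num_rec den_rec Pn Qn HK)
    as [L [HL Hinc]]; trivial.
  { intros z z' n Hz Hz' _; now apply Hlip; apply Hsub. }
  { intros z z' n Hz Hz' _; now apply Hlip; apply Hsub. }
  destruct (family_inv_upper (disc r) P Q num N c0 num_rec Pn Qn Hc0 Hnearby)
    as [k [_ Hk]].
  assert (Hne : forall z n, disc r z -> (S N <= n)%nat -> num n z <> 0)
    by (intros z n Hz Hn; now apply Hk).
  assert (Hth : (0 <= 91 / 100 < 1)%R) by lra.
  set (F := fun n z => den n z / num n z).
  set (f := fun z => epsilon (inhabits (RtoC 0)) (C_cv (fun n => F n z))).
  assert (Hf : forall z, disc r z -> C_cv (fun n => F n z) (f z)).
  { intros z Hz; apply epsilon_spec.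
    apply (geometric_cv (91 / 100) Hth _ L (S N) HL); intros n Hn; now apply Hinc. }
  exists r, f; split; trivial; intros z Hz; split.
  - apply (geometric_limit_derivable (91 / 100) Hth (disc r) F f L (S N)); trivial.
    + exists (r - Cmod (z - z0))%R; split; [unfold disc in Hz; lra|].
      intros w Hw; unfold disc.
      replace (w - z0) with ((w - z) + (z - z0)) by ring.
      eapply Rle_lt_trans; [apply Cmod_triangle|lra].
    + intros n Hn; apply (C_derivable_mult (den n) (fun w => / num n w)).
      * exact (proj2 (convergents_derivable n z)).
      * apply (C_derivable_inv (num n)); [exact (Hne z n Hz Hn)|].
        exact (proj1 (convergents_derivable n z)).
    + intros n w w' Hn Hw Hw'; now apply Hinc.
  - apply (is_CF_of_reciprocal_limit _ _ _ (S N)).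
    + intros n Hn; apply fact_scaled_neq_0, (Hne z n Hz Hn).
    + intros eps Heps; destruct (Hf z Hz eps Heps) as [n0 Hn0].
      exists (S N + n0)%nat; intros n Hn.
      rewrite <- fact_scaled_ratio.
      * apply Hn0; lia.
      * apply fact_scaled_neq_0, (Hne z n Hz); lia.
Qed.

(** Applied three times, with the identity in one place and constants in the other two, this treats
    the three variables at once. *)
Lemma H_regular_along :
  (exists v, is_CF (H_a (pa z0) (pb z0)) (H_b (pa z0) (pb z0) (pc z0)) v) /\
  regular_at (fun z => H (pa z) (pb z) (pc z)) z0.
Proof.
  destruct reciprocal_limit_derivable as [r [f [Hr Hf]]]; split.
  - destruct (Hf z0) as [_ [v [Hv _]]]; [|now exists v].
    unfold disc; replace (z0 - z0) with (RtoC 0) by ring; now rewrite Cmod_0.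
  - exists f; apply (Cmod_lt_locally z0 r); trivial; intros z Hz.
    destruct (Hf z Hz) as [Hd [v [Hv Hi]]]; split; trivial.
    now apply (CF_sphere_inv _ _ v).
Qed.

End Curve.

Lemma const_lipschitz (c z z' : C) : (Cmod (c - c) <= Cmod (z - z'))%R.
Proof.
  replace (c - c) with (RtoC 0) by ring; rewrite Cmod_0; apply Cmod_ge_0.
Qed.

Theorem lemma2p3 :
  forall alpha beta gamma : C,
    H_domain alpha beta gamma ->
    (exists v : sphere, is_CF (H_a alpha beta) (H_b alpha beta gamma) v) /\
    regular_at (fun z : C => H z beta gamma) alpha /\
    regular_at (fun z : C => H alpha z gamma) beta /\
    regular_at (fun z : C => H alpha beta z) gamma.
Proof.
  intros alpha beta gamma Hdom.
  assert (Hid : forall z z' : C, (Cmod (z - z') <= Cmod (z - z'))%R) by (intros; lra).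
  destruct (H_regular_along (fun z => z) (fun _ => beta) (fun _ => gamma) alpha)
    as [Hv Ha]; auto using const_lipschitz, C_derivable_id, C_derivable_const.
  destruct (H_regular_along (fun _ => alpha) (fun z => z) (fun _ => gamma) beta)
    as [_ Hb]; auto using const_lipschitz, C_derivable_id, C_derivable_const.
  destruct (H_regular_along (fun _ => alpha) (fun _ => beta) (fun z => z) gamma)
    as [_ Hc]; auto using const_lipschitz, C_derivable_id, C_derivable_const.
Qed.
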